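(* Let $\mathbb Z\langle X\rangle$ be the free unital associative ring on the countably infinite set $X=\{x_1,x_2,\dots\}$. Let $T^{(4)}$ be the two-sided ideal generated by all $[a_1,a_2,a_3,a_4]$, and let $T^{(3,2)}$ be the two-sided ideal generated by all $[a_1,a_2,a_3,a_4]$ and all $[a_1,a_2][a_3,a_4,a_5]$ ($a_i\in\mathbb Z\langle X\rangle$). Let \[\mathcal E=\{x_{j_1}\cdots x_{j_l}[x_{i_1},x_{i_2}]\cdots[x_{i_{2k-1}},x_{i_{2k}}][x_{i_{2k+1}},x_{i_{2k+2}},x_{i_{2k+3}}] \mid l\ge0,\ k\ge1,\ j_1\le\dots\le j_l,\ i_1<i_2<\dots<i_{2k+3}\}.\] Then $T^{(3,2)}/T^{(4)}$ is an elementary abelian $3$-group and $\{e+T^{(4)}\mid e\in\mathcal E\}$ is a basis of it over $\mathbb F_3=\mathbb Z/3\mathbb Z$.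
   Context: Commutators are left-normed: $[a,b]=ab-ba$, $[a_1,\dots,a_n]=[[a_1,\dots,a_{n-1}],a_n]$. For $l=0$ the monomial prefix is empty (equal to $1$). *)

(* Defs.v *)
(* The free unital associative ring Z<X> on X = {x_0, x_1, ...}
   is the monoid algebra (multinomials' monalg) with integer coefficients over
   the free monoid of words (seq nat, concatenation). *)
From HB Require Import structures.
From mathcomp Require Import all_boot all_order all_algebra.
From mathcomp Require Import finmap.
From mathcomp.multinomials Require Import monalg.
Set Implicit Arguments. Unset Strict Implicit. Unset Printing Implicit Defensive.
Import Order.TTheory GRing.Theory Num.Theory.
Local Open Scope ring_scope.

Definition word := seq nat.
HB.instance Definition _ := Choice.on word.

Lemma word_mulA : associative (@cat nat). Proof. exact: catA. Qed.
Lemma word_mul1 : left_id (@nil nat) (@cat nat). Proof. by []. Qed.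
Lemma word_mulr1 : right_id (@nil nat) (@cat nat). Proof. exact: cats0. Qed.
Lemma word_unit (x y : word) : x ++ y = [::] -> x = [::] /\ y = [::].
Proof. by case: x; case: y. Qed.

HB.instance Definition _ := Choice_isMonomialDef.Build word
  word_mulA word_mul1 word_mulr1 word_unit.

Definition ZX := {malg int[word]}.

Definition xvar (i : nat) : ZX := << ([:: i] : word) >>.

Definition comm (a b : ZX) : ZX := a * b - b * a.
Definition comm3 (a b c : ZX) : ZX := comm (comm a b) c.
Definition comm4 (a b c d : ZX) : ZX := comm (comm3 a b c) d.

Definition in_ideal (S : ZX -> Prop) (f : ZX) : Prop :=
  exists (n : nat) (u v s : 'I_n -> ZX),
    (forall i, S (s i)) /\ f = \sum_(i < n) u i * s i * v i.

Definition gen4 (g : ZX) : Prop :=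
  exists a1 a2 a3 a4, g = comm4 a1 a2 a3 a4.
Definition gen32 (g : ZX) : Prop :=
  gen4 g \/ exists a1 a2 a3 a4 a5, g = comm a1 a2 * comm3 a3 a4 a5.

Definition T4 : ZX -> Prop := in_ideal gen4.
Definition T32 : ZX -> Prop := in_ideal gen32.

(* The set E: x_{j_1}...x_{j_l} [x_{i_1},x_{i_2}]...[x_{i_{2k-1}},x_{i_{2k}}]
   [x_{i_{2k+1}},x_{i_{2k+2}},x_{i_{2k+3}}], l >= 0, k >= 1,
   j_1 <= ... <= j_l, i_1 < ... < i_{2k+3}  (indices 0-based in the seqs). *)
Definition Eelt (js ids : seq nat) (k : nat) : ZX :=
  (\prod_(j <- js) xvar j)
  * (\prod_(t < k) comm (xvar (nth 0%N ids (2 * t))) (xvar (nth 0%N ids (2 * t).+1)))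
  * comm3 (xvar (nth 0%N ids (2 * k))) (xvar (nth 0%N ids (2 * k).+1))
          (xvar (nth 0%N ids (2 * k).+2)).

Definition in_calE (e : ZX) : Prop :=
  exists (js ids : seq nat) (k : nat),
    [/\ (1 <= k)%N, size ids = (2 * k + 3)%N, sorted leq js, sorted ltn ids
      & e = Eelt js ids k].

(* Main.v *)
(* Write F(a,b,c,d,e) for [a,b][c,d,e].

   In a ring satisfying [a,b,c,d] = 0, expanding [c,d,ae,b] and [ca,b,d,e] shows
   that F is alternating in its five arguments, and the Jacobi identity then gives
   3F = 0.  It follows that triple commutators annihilate each other, that F is
   central and a derivation in each argument, and that
   [a_1,a_2]...[a_(2k-1),a_2k][a_(2k+1),a_(2k+2),a_(2k+3)] is alternating.  Hence
   the set E spans the image of T^(3,2).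

   For independence, let Lambda be generated over F_3[t_i] by anticommuting
   elements theta_i and eps, and put d = sum_j theta_j d/dt_j.  On Lambda let x_m act as
     t_m + theta_m + eps theta_m sum_(j < k, j < m) theta_j theta_k d/dt_j d/dt_k.
   Because 3 = 0,
     [x_i,x_j] = 2 theta_i theta_j + eps theta_i theta_j d  and
     [x_i,x_j,x_k] = eps theta_i theta_j theta_k,
   so the generators satisfy the relations of Z<X>/T^(4), and an induction on the
   degree extends [a,b,c,d] = 0 to the whole ring they generate.  An element of E
   applied to 1 has, up to a unit, leading term
   t_(j_1)...t_(j_l) eps theta_(i_1)...theta_(i_(2k+3)). *)
Require Import Defs.
From HB Require Import structures.
From mathcomp Require Import all_boot all_order all_algebra.
From mathcomp Require Import finmap.
From mathcomp.multinomials Require Import monalg.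
From mathcomp Require Import zify.
From mathcomp Require Import boolp functions ring_quotient generic_quotient.
From Stdlib Require Ncring Ncring_tac.
Set Implicit Arguments. Unset Strict Implicit. Unset Printing Implicit Defensive.
Import Order.TTheory GRing.Theory Num.Theory.
Local Open Scope ring_scope.

(** * Rings with [a,b,c,d] = 0 *)

Section NonCommutativeRing.
Variable Q : pzRingType.

Definition ncring_ops :
  @Ncring.Ring_ops Q 0 1 +%R *%R (fun x y => x - y) -%R eq :=
  @Ncring.Build_Ring_ops Q 0 1 +%R *%R (fun x y => x - y) -%R eq.

Lemma ncring : @Ncring.Ring Q 0 1 +%R *%R (fun x y => x - y) -%R eq ncring_ops.
Proof.
constructor; try typeclasses eauto.
- exact: add0r.
- exact: addrC.
- exact: addrA.
- exact: mul1r.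
- exact: mulr1.
- exact: mulrA.
- exact: mulrDl.
- by move=> x y t; exact: mulrDr.
- by [].
- exact: subrr.
Qed.

Definition cm (a b : Q) := a * b - b * a.
Definition cm3 (a b c : Q) := cm (cm a b) c.
Definition cm23 (a b c d e : Q) := cm a b * cm3 c d e.
End NonCommutativeRing.

#[local] Existing Instance ncring_ops.
#[local] Existing Instance ncring.

Ltac ncr := rewrite /= /cm23 /cm3 /cm; Ncring_tac.non_commutative_ring.

Lemma cm0P (Q : pzRingType) (a b : Q) : cm a b = 0 <-> a * b = b * a.
Proof. by rewrite /cm; split=> [/eqP|->]; rewrite ?subrr // subr_eq0 => /eqP. Qed.

Section LieNilpotentClass3.
Variable Q : pzRingType.
Hypothesis nilQ : forall a b c d : Q, cm (cm3 a b c) d = 0.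
Implicit Types a b c d e f u v w : Q.

Lemma cm3C a b c d : cm3 a b c * d = d * cm3 a b c.
Proof. exact/cm0P. Qed.

Lemma cm23_swap12 a b c d e : cm23 a b c d e = - cm23 b a c d e.
Proof. by ncr. Qed.

Lemma cm23_swap34 a b c d e : cm23 a b c d e = - cm23 a b d c e.
Proof. by ncr. Qed.

(** Leibniz on [[c,d,ae,b]] leaves exactly these two products; every other term contains a
    commutator with a triple commutator, zero by [nilQ]. *)
Lemma cm23_swap15 a b c d e : cm23 a b c d e = - cm23 e b c d a.
Proof.
have E : cm23 a b c d e + cm23 e b c d a = cm (cm3 c d (a * e)) b
    - a * cm (cm3 c d e) b - cm (cm3 c d a) b * e - cm (cm3 c d a) (cm e b).
  by ncr.
by apply/eqP; rewrite -addr_eq0 E !nilQ !(mulr0, mul0r, subr0).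
Qed.

Lemma cm23_swap25 a b c d e : cm23 a b c d e = - cm23 a e c d b.
Proof. by rewrite cm23_swap12 cm23_swap15 cm23_swap12 !opprK. Qed.

(** Expanding [[ca,b,d,e]] gives these two products, terms killed by [nilQ], and two further pairs,
    each cancelling under exchange of arguments 2 and 5. *)
Lemma cm23_swap13 a b c d e : cm23 a b c d e = - cm23 c b a d e.
Proof.
have E : cm23 a b c d e + cm23 c b a d e = cm (cm3 (c * a) b d) e
   - c * cm (cm3 a b d) e - cm (cm3 c b d) e * a
   - (cm23 c e a b d + cm23 c d a b e) - (cm23 a d c b e + cm23 a e c b d)
   - cm (cm3 c d e) (cm a b) - cm (cm3 c b e) (cm a d) - cm (cm3 c b d) (cm a e).
  by ncr.
apply/eqP; rewrite -addr_eq0 E !nilQ !(mulr0, mul0r, subr0).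
by rewrite (cm23_swap25 c) addNr (cm23_swap25 a) addNr !subr0.
Qed.

Lemma cm23_swap35 a b c d e : cm23 a b c d e = - cm23 a b e d c.
Proof. by rewrite cm23_swap13 cm23_swap15 cm23_swap13 !opprK. Qed.

Lemma cm23_swap45 a b c d e : cm23 a b c d e = - cm23 a b c e d.
Proof. by rewrite cm23_swap34 cm23_swap35 cm23_swap34 !opprK. Qed.

Lemma cm23_swap23 a b c d e : cm23 a b c d e = - cm23 a c b d e.
Proof. by rewrite cm23_swap12 cm23_swap13 cm23_swap12 !opprK. Qed.

(* Jacobi: the three cyclic rotations of the last three arguments are even. *)
Lemma cm23_mul3 a b c d e : cm23 a b c d e *+ 3 = 0.
Proof.
have E : cm23 a b c d e + cm23 a b d e c + cm23 a b e c d = 0 by ncr.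
rewrite -[RHS]E [cm23 a b d e c]cm23_swap45 [cm23 a b d c e]cm23_swap34.
by rewrite [cm23 a b e c d]cm23_swap34 [cm23 a b c e d]cm23_swap45 !opprK !mulrS addr0 addrA.
Qed.

Lemma cm_cm a b c d : cm (cm a b) (cm c d) = 0.
Proof.
have -> : cm (cm a b) (cm c d) = cm (cm3 a b c) d - cm (cm3 a b d) c by ncr.
by rewrite !nilQ subr0.
Qed.

Lemma cmC a b c d : cm a b * cm c d = cm c d * cm a b.
Proof. exact/cm0P/cm_cm. Qed.

(** The product is a [cm23] with first argument [[a,b]]; exchanging arguments 1 and 5 moves [[a,b]]
    into the triple commutator, which then vanishes by [cm_cm]. *)
Lemma cm3_cm3 a b c d e f : cm3 a b c * cm3 d e f = 0.
Proof.
rewrite -/(cm23 (cm a b) c d e f) cm23_swap15.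
by rewrite /cm23 [cm3 d e _]cm_cm mulr0 oppr0.
Qed.

Lemma cm23C a b c d e w : cm23 a b c d e * w = w * cm23 a b c d e.
Proof.
apply/cm0P; have -> : cm (cm23 a b c d e) w =
  cm a b * cm (cm3 c d e) w + cm3 a b w * cm3 c d e by ncr.
by rewrite nilQ cm3_cm3 mulr0 addr0.
Qed.

(** The cross term is a product of two triple commutators, hence zero; centrality moves [v] to the
    left. Alternation carries the rule to the other arguments. *)
Lemma cm23_M5 a b c d u v :
  cm23 a b c d (u * v) = u * cm23 a b c d v + v * cm23 a b c d u.
Proof.
rewrite -[v * _]cm23C; have -> : cm23 a b c d (u * v) =
  u * cm23 a b c d v + cm23 a b c d u * v + cm3 a b u * cm3 c d v by ncr.
by rewrite cm3_cm3 addr0.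
Qed.

Lemma cm23_M1 u v b c d e :
  cm23 (u * v) b c d e = u * cm23 v b c d e + v * cm23 u b c d e.
Proof.
by rewrite cm23_swap15 cm23_M5 (cm23_swap15 v b c d e) (cm23_swap15 u b c d e) !mulrN opprD.
Qed.

Lemma cm23_M2 a u v c d e :
  cm23 a (u * v) c d e = u * cm23 a v c d e + v * cm23 a u c d e.
Proof.
by rewrite cm23_swap25 cm23_M5 (cm23_swap25 a v c d e) (cm23_swap25 a u c d e) !mulrN opprD.
Qed.

Lemma cm23_M3 a b u v d e :
  cm23 a b (u * v) d e = u * cm23 a b v d e + v * cm23 a b u d e.
Proof.
by rewrite cm23_swap35 cm23_M5 (cm23_swap35 a b v d e) (cm23_swap35 a b u d e) !mulrN opprD.
Qed.

Lemma cm23_M4 a b c u v e :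
  cm23 a b c (u * v) e = u * cm23 a b c v e + v * cm23 a b c u e.
Proof.
by rewrite cm23_swap45 cm23_M5 (cm23_swap45 a b c v e) (cm23_swap45 a b c u e) !mulrN opprD.
Qed.

Lemma cm_cm23C a b c d e f g :
  cm a b * cm23 c d e f g = cm c d * cm23 a b e f g.
Proof. by rewrite /cm23 mulrA cmC mulrA. Qed.

(** Since commutators commute with each other, [b] and [c] can be brought into a common [cm23],
    where alternation applies. *)
Lemma cm_cm23_swap a b c d e f g :
  cm a b * cm23 c d e f g = - (cm a c * cm23 b d e f g).
Proof.
rewrite cm23_swap13 mulrN cm_cm23C (cm23_swap23 a b c) mulrN opprK.
by rewrite cm_cm23C cm23_swap13 mulrN.
Qed.

End LieNilpotentClass3.

(** * Reduction to relations between generators *)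

(** Bracketed nonempty monomials: a root [Node] is a ready splitting into two factors of smaller
    degree. *)
Inductive mag := Leaf of nat | Node of mag & mag.

Fixpoint msz (a : mag) : nat :=
  if a is Node u v then (msz u + msz v)%N else 1%N.

Lemma msz_gt0 a : (0 < msz a)%N.
Proof. by elim: a => //= u IHu v IHv; rewrite addn_gt0 IHu. Qed.

Ltac msz_lia :=
  repeat match goal with a : mag |- _ =>
    lazymatch goal with
    | _ : is_true (0 < msz a)%N |- _ => fail
    | _ => have := msz_gt0 a; move=> ?
    end end;
  rewrite /=; lia.

(* The four identities are proved simultaneously by induction on the total degree:
   expanding a product in one argument of one of them produces instances of the
   others of the same degree but with more arguments. *)
Section Generators.
Variables (Q : pzRingType) (x : nat -> Q).

Fixpoint mev (a : mag) : Q :=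
  match a with Leaf i => x i | Node u v => mev u * mev v end.

Local Notation y a b := (cm (mev a) (mev b)).
Local Notation z a b c := (cm3 (mev a) (mev b) (mev c)).
Local Notation F a b c d e := (cm23 (mev a) (mev b) (mev c) (mev d) (mev e)).

(** Such sums are the cross terms when a product is expanded in the third argument of [cm23], so the
    induction has to carry their vanishing along. *)
Definition alt4 (a b c d e f : Q) :=
  (cm a b * cm c d + cm a c * cm b d) * cm e f.

Hypothesis x_nil : forall i j k l, cm (cm3 (x i) (x j) (x k)) (x l) = 0.
Hypothesis x_swap15 : forall i j k l m,
  cm23 (x i) (x j) (x k) (x l) (x m) = - cm23 (x m) (x j) (x k) (x l) (x i).
Hypothesis x_swap13 : forall i j k l m,
  cm23 (x i) (x j) (x k) (x l) (x m) = - cm23 (x k) (x j) (x i) (x l) (x m).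
Hypothesis x_alt4 : forall i j k l m p,
  alt4 (x i) (x j) (x k) (x l) (x m) (x p) = 0.
Hypothesis x_cm3 : forall i j k l m p,
  cm3 (x i) (x j) (x k) * cm3 (x l) (x m) (x p) = 0.

Definition nil_at n := forall a b c d,
  (msz a + msz b + msz c + msz d)%N = n -> cm (z a b c) (mev d) = 0.
Definition swap_at n := forall a b c d e,
  (msz a + msz b + msz c + msz d + msz e)%N = n ->
  F a b c d e = - F e b c d a /\ F a b c d e = - F c b a d e.
Definition alt4_at n := forall a b c d e f,
  (msz a + msz b + msz c + msz d + msz e + msz f)%N = n ->
  alt4 (mev a) (mev b) (mev c) (mev d) (mev e) (mev f) = 0.
Definition cm3_at n := forall a b c d e f,
  (msz a + msz b + msz c + msz d + msz e + msz f)%N = n ->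
  z a b c * z d e f = 0.

Section Step.
Variable n : nat.
Hypothesis IHnil : forall m, (m < n)%N -> nil_at m.
Hypothesis IHswap : forall m, (m < n)%N -> swap_at m.
Hypothesis IHalt4 : forall m, (m < n)%N -> alt4_at m.
Hypothesis IHcm3 : forall m, (m < n)%N -> cm3_at m.

Lemma step_nil a b c d : (msz a + msz b + msz c + msz d < n)%N ->
  cm (z a b c) (mev d) = 0.
Proof. by move=> h; apply: (IHnil h). Qed.

Lemma step_cmC a b c d : (msz a + msz b + msz c + msz d < n)%N ->
  y a b * y c d = y c d * y a b.
Proof.
move=> h; apply/cm0P.
have -> : cm (y a b) (y c d) = cm (z a b c) (mev d) - cm (z a b d) (mev c) by ncr.
by rewrite !step_nil ?subr0 //; lia.
Qed.

(** By Jacobi this is a difference of iterated commutators. Total degree [n] is allowed because each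
    inner four-argument commutator omits an argument of positive degree. *)
Lemma step_cm3_cm a b c d e : (msz a + msz b + msz c + msz d + msz e <= n)%N ->
  cm (z a b c) (y d e) = 0.
Proof.
move=> h; have -> : cm (z a b c) (y d e) =
  cm (cm (z a b c) (mev d)) (mev e) - cm (cm (z a b c) (mev e)) (mev d) by ncr.
by rewrite !step_nil; [rewrite /cm !(mulr0, mul0r, subr0)|msz_lia..].
Qed.

Section Swaps.
Variables (a b c d e : mag) (h : (msz a + msz b + msz c + msz d + msz e < n)%N).

Lemma step_swap15 : F a b c d e = - F e b c d a.
Proof. by case: (IHswap h (erefl _) : _ /\ _). Qed.
Lemma step_swap13 : F a b c d e = - F c b a d e.
Proof. by case: (IHswap h (erefl _) : _ /\ _). Qed.
End Swaps.

Lemma step_swap23 a b c d e : (msz a + msz b + msz c + msz d + msz e < n)%N ->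
  F a b c d e = - F a c b d e.
Proof.
move=> h; rewrite cm23_swap12 step_swap13 1?cm23_swap12 ?opprK //; lia.
Qed.

Lemma step_swap14 a b c d e : (msz a + msz b + msz c + msz d + msz e < n)%N ->
  F a b c d e = - F d b c a e.
Proof.
move=> h; rewrite cm23_swap34 step_swap13 1?cm23_swap34 ?opprK //; lia.
Qed.

Lemma step_cm_cm23C a b c d e f g :
  (msz a + msz b + msz c + msz d + msz e + msz f + msz g <= n)%N ->
  y a b * F c d e f g = y c d * F a b e f g.
Proof. by move=> h; rewrite /cm23 mulrA step_cmC ?mulrA //; msz_lia. Qed.

Lemma step_cm_cm23_swap a b c d e f g :
  (msz a + msz b + msz c + msz d + msz e + msz f + msz g <= n)%N ->
  y a b * F c d e f g = - (y a c * F b d e f g).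
Proof.
move=> h; rewrite step_swap13; last by msz_lia.
rewrite mulrN step_cm_cm23C; last by lia.
rewrite step_swap23; last by msz_lia.
rewrite mulrN opprK step_cm_cm23C; last by lia.
by rewrite step_swap13 ?mulrN //; msz_lia.
Qed.

Lemma step_cm3 : cm3_at n.
Proof.
(* The two factors commute, so only the arguments of the first factor have to be split. *)
have symm a b c d e f : (msz a + msz b + msz c + msz d + msz e + msz f)%N = n ->
    z a b c * z d e f = z d e f * z a b c.
  move=> h; apply/cm0P.
  have -> : cm (z a b c) (z d e f) = cm (cm (z a b c) (y d e)) (mev f)
     + cm (y d e) (cm (z a b c) (mev f)) by ncr.
  rewrite [cm (z a b c) (mev f)]step_nil; last by msz_lia.
  rewrite step_cm3_cm; last by msz_lia.
  by rewrite /cm !(mulr0, mul0r, subr0, addr0).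
have node1 u v b c d e f :
    (msz u + msz v + msz b + msz c + msz d + msz e + msz f)%N = n ->
    z (Node u v) b c * z d e f = 0.
  move=> h.
  (* The Leibniz cross terms [[u,b][v,c] + [u,c][v,b]], multiplied by [[d,e,f]], cancel by
     [step_cm_cm23_swap]. *)
  have -> : z (Node u v) b c * z d e f = mev u * (z v b c * z d e f) +
     (y u c * F v b d e f + y u b * F v c d e f)
     + (z u b c * z d e f) * mev v - z u b c * cm (z d e f) (mev v) by ncr.
  rewrite !(IHcm3 _ (erefl _)) ?step_nil; [|by msz_lia..].
  rewrite (cm23_swap12 (mev v) (mev b)) (cm23_swap12 (mev v) (mev c)) !mulrN.
  rewrite (@step_cm_cm23_swap u c b) ?opprK ?subrr; last by msz_lia.
  by rewrite /cm !(mulr0, mul0r, addr0, subr0).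
have slot1 a b c d e f : (msz a + msz b + msz c + msz d + msz e + msz f)%N = n ->
    (forall i, a <> Leaf i) -> z a b c * z d e f = 0.
  case: a => [i|u v] h ha; first by case: (ha i).
  by apply: node1; rewrite -h /=; lia.
have slot2 a b c d e f : (msz a + msz b + msz c + msz d + msz e + msz f)%N = n ->
    (forall i, b <> Leaf i) -> z a b c * z d e f = 0.
  move=> h hb; have -> : z a b c = - z b a c by ncr.
  by rewrite mulNr slot1 ?oppr0 //; lia.
have slot3 a b c d e f : (msz a + msz b + msz c + msz d + msz e + msz f)%N = n ->
    (forall i, c <> Leaf i) -> z a b c * z d e f = 0.
  case: c => [i|u v] h hc; first by case: (hc i).
  have -> : z a b (Node u v) * z d e f = mev u * (z a b v * z d e f) +
     (z a b u * z d e f) * mev v - z a b u * cm (z d e f) (mev v) by ncr.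
  move: h; rewrite /= => h.
  by rewrite !(IHcm3 _ (erefl _)) ?step_nil ?(mulr0, mul0r, addr0, subr0) //; msz_lia.
have leafP a : {i | a = Leaf i} + (forall i, a <> Leaf i).
  by case: a => [i|u v]; [left; exists i|right].
move=> a b c d e f h.
case: (leafP a) => [[i ai]|/slot1->//].
case: (leafP b) => [[j bj]|/slot2->//].
case: (leafP c) => [[k ck]|/slot3->//].
rewrite symm //.
case: (leafP d) => [[i' di]|/slot1->//]; last by lia.
case: (leafP e) => [[j' ej]|/slot2->//]; last by lia.
case: (leafP f) => [[k' fk]|/slot3->//]; last by lia.
by rewrite ai bj ck di ej fk; exact: x_cm3.
Qed.

Lemma step_alt4 : alt4_at n.
Proof.
(* Splitting arguments 1, 2 and 5 is enough: the three symmetries carry 3 to 2, 4 to 1 and 6 to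
   5. *)
have symBC (a b c d e f : Q) : alt4 a b c d e f = alt4 a c b d e f.
  by rewrite /alt4 addrC.
have symAD a b c d e f : (msz a + msz b + msz c + msz d + msz e + msz f)%N = n ->
    alt4 (mev a) (mev b) (mev c) (mev d) (mev e) (mev f) =
    alt4 (mev d) (mev b) (mev c) (mev a) (mev e) (mev f).
  move=> h; rewrite /alt4 (@step_cmC a b c d); last by msz_lia.
  by congr (_ * _); rewrite [y a c * _]step_cmC; [ncr|msz_lia].
have symEF (a b c d e f : Q) : alt4 a b c d e f = - alt4 a b c d f e.
  by rewrite /alt4; ncr.
have slot1 a b c d e f : (msz a + msz b + msz c + msz d + msz e + msz f)%N = n ->
    (forall i, a <> Leaf i) -> alt4 (mev a) (mev b) (mev c) (mev d) (mev e) (mev f) = 0.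
  case: a => [i|u v] h ha; first by case: (ha i).
  have -> : alt4 (mev (Node u v)) (mev b) (mev c) (mev d) (mev e) (mev f) =
     mev u * alt4 (mev v) (mev b) (mev c) (mev d) (mev e) (mev f) +
     alt4 (mev u) (mev b) (mev c) (mev d) (mev e) (mev f) * mev v
     - (y u b * F c d e f v + y u c * F b d e f v)
     - (F u b c d v + F u c b d v) * y e f by rewrite /alt4; ncr.
  move: h; rewrite /= => h; rewrite !(IHalt4 _ (erefl _)); [|by msz_lia..].
  rewrite (@step_swap23 u b c); last by msz_lia.
  rewrite (@step_cm_cm23_swap u b c); last by msz_lia.
  by rewrite !addNr !(mulr0, mul0r, addr0, subr0).
have slot2 a b c d e f : (msz a + msz b + msz c + msz d + msz e + msz f)%N = n ->
    (forall i, b <> Leaf i) -> alt4 (mev a) (mev b) (mev c) (mev d) (mev e) (mev f) = 0.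
  case: b => [i|u v] h ha; first by case: (ha i).
  have -> : alt4 (mev a) (mev (Node u v)) (mev c) (mev d) (mev e) (mev f) =
     mev u * alt4 (mev a) (mev v) (mev c) (mev d) (mev e) (mev f) +
     alt4 (mev a) (mev u) (mev c) (mev d) (mev e) (mev f) * mev v
     - (y a u * F c d e f v + y a c * F u d e f v)
     + (cm (z a c u) (y v d) + F v d a c u - F a u c d v) * y e f by rewrite /alt4; ncr.
  move: h; rewrite /= => h; rewrite !(IHalt4 _ (erefl _)); [|by msz_lia..].
  rewrite (@step_cm_cm23_swap a u c) ?addNr; last by msz_lia.
  rewrite step_cm3_cm; last by msz_lia.
  rewrite (@step_swap15 v d a c u) ?(@step_swap13 u d a c v); [|by msz_lia..].
  rewrite (@step_swap23 a d u c v) ?(cm23_swap34 _ _ (mev d)); last by msz_lia.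
  by rewrite !opprK addrK ?(mulr0, mul0r, addr0, subr0).
have slot5 a b c d e f : (msz a + msz b + msz c + msz d + msz e + msz f)%N = n ->
    (forall i, e <> Leaf i) -> alt4 (mev a) (mev b) (mev c) (mev d) (mev e) (mev f) = 0.
  case: e => [i|u v] h ha; first by case: (ha i).
  have -> : alt4 (mev a) (mev b) (mev c) (mev d) (mev (Node u v)) (mev f) =
     mev u * alt4 (mev a) (mev b) (mev c) (mev d) (mev v) (mev f) +
     alt4 (mev a) (mev b) (mev c) (mev d) (mev u) (mev f) * mev v
     + ((F a b c d u + F a c b d u) + (F c d a b u + F b d a c u)
        + cm (z a b u) (y c d) + cm (z a c u) (y b d)) * y v f by rewrite /alt4; ncr.
  move: h; rewrite /= => h; rewrite !(IHalt4 _ (erefl _)); [|by msz_lia..].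
  rewrite !step_cm3_cm; [|by msz_lia..].
  rewrite (@step_swap23 a b c); last by msz_lia.
  rewrite (@step_swap14 c d a b); last by msz_lia.
  by rewrite !addNr !(mulr0, mul0r, addr0, subr0).
have leafP a : {i | a = Leaf i} + (forall i, a <> Leaf i).
  by case: a => [i|u v]; [left; exists i|right].
move=> a b c d e f h.
case: (leafP a) => [[i ai]|/slot1->//].
case: (leafP b) => [[j bj]|/slot2->//].
case: (leafP c) => [[k ck]|hc]; last by rewrite symBC slot2 //; lia.
case: (leafP d) => [[i' di]|hd]; last by rewrite symAD // slot1 //; lia.
case: (leafP e) => [[j' ej]|/slot5->//].
case: (leafP f) => [[k' fk]|hf]; last by rewrite symEF slot5 ?oppr0 //; lia.
by rewrite ai bj ck di ej fk; exact: x_alt4.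
Qed.

Section CentralProducts.
Variables (a b c d e v : mag).
Hypothesis h : (msz a + msz b + msz c + msz d + msz e + msz v)%N = n.

Lemma step_cm23C : F a b c d e * mev v = mev v * F a b c d e.
Proof.
apply/cm0P; have -> : cm (F a b c d e) (mev v) =
  y a b * cm (z c d e) (mev v) + z a b v * z c d e by ncr.
by rewrite step_nil ?step_cm3 ?(mulr0, addr0) //; msz_lia.
Qed.
End CentralProducts.

(* The product rule in each argument of [cm23]: a swap relation with a product
   in one slot thereby reduces to swap relations of smaller degree. *)
Lemma step_M1 u v b c d e :
  (msz u + msz v + msz b + msz c + msz d + msz e)%N = n ->
  F (Node u v) b c d e = mev u * F v b c d e + mev v * F u b c d e.
Proof.
move=> h; rewrite -[mev v * _]step_cm23C; last by lia.
have -> : F (Node u v) b c d e =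
  mev u * F v b c d e + F u b c d e * mev v - y u b * cm (z c d e) (mev v) by ncr.
by rewrite step_nil ?mulr0 ?subr0 //; msz_lia.
Qed.

Lemma step_M2 a u v c d e :
  (msz a + msz u + msz v + msz c + msz d + msz e)%N = n ->
  F a (Node u v) c d e = mev u * F a v c d e + mev v * F a u c d e.
Proof.
move=> h; rewrite cm23_swap12 step_M1 1?(cm23_swap12 (mev a) (mev v)); last by lia.
by rewrite (cm23_swap12 (mev a) (mev u)) opprD !mulrN.
Qed.

Lemma step_M3 a b u v d e :
  (msz a + msz b + msz u + msz v + msz d + msz e)%N = n ->
  F a b (Node u v) d e = mev u * F a b v d e + mev v * F a b u d e.
Proof.
move=> h; rewrite -[mev v * _]step_cm23C; last by lia.
have -> : F a b (Node u v) d e = mev u * F a b v d e + F a b u d e * mev v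
  + z a b u * z v d e
  + (y a b * y u e * y v d + y a b * y u d * y v e) by ncr.
rewrite step_cm3 ?addr0; last by lia.
(* Once [[a,b]] is moved to the end, the cross terms form an [alt4], already known to vanish at
   degree [n]. *)
suff -> : y a b * y u e * y v d + y a b * y u d * y v e =
    - alt4 (mev e) (mev u) (mev v) (mev d) (mev a) (mev b).
  by rewrite step_alt4 ?oppr0 ?addr0 //; lia.
rewrite (@step_cmC a b u e) 1?(@step_cmC a b u d); [|by msz_lia..].
rewrite -2!mulrA (@step_cmC a b v d) 1?(@step_cmC a b v e); [|by msz_lia..].
rewrite !mulrA (@step_cmC u d v e); last by msz_lia.
by rewrite /alt4; ncr.
Qed.

Lemma step_M4 a b c u v e :
  (msz a + msz b + msz c + msz u + msz v + msz e)%N = n ->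
  F a b c (Node u v) e = mev u * F a b c v e + mev v * F a b c u e.
Proof.
move=> h; rewrite cm23_swap34 step_M3 1?(cm23_swap34 (mev a) (mev b) (mev c) (mev v)); last by lia.
by rewrite (cm23_swap34 (mev a) (mev b) (mev c) (mev u)) opprD !mulrN.
Qed.

Lemma step_M5 a b c d u v :
  (msz a + msz b + msz c + msz d + msz u + msz v)%N = n ->
  F a b c d (Node u v) = mev u * F a b c d v + mev v * F a b c d u.
Proof.
move=> h; rewrite -[mev v * _]step_cm23C; last by lia.
have -> : F a b c d (Node u v) = mev u * F a b c d v + F a b c d u * mev v
  + z a b u * z c d v by ncr.
by rewrite step_cm3 ?addr0 //; lia.
Qed.

Lemma step_swap : swap_at n.
Proof.
move=> a b c d e h; split; move: h.
(* The first argument that is a product is split on both sides by the product rule, leaving swaps of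
   smaller degree; five leaves are the hypothesis on generators. *)
- case: a => [i|u v] h; first last.
    rewrite step_M1 1?step_M5; [|by move: h => /=; msz_lia..].
    rewrite opprD -(mulrN (mev u)) -(mulrN (mev v)) -!step_swap15 //; move: h => /=; msz_lia.
  case: b h => [j|u v] h; first last.
    rewrite !step_M2; [|by move: h => /=; msz_lia..].
    rewrite opprD -(mulrN (mev u)) -(mulrN (mev v)) -!step_swap15 //; move: h => /=; msz_lia.
  case: c h => [k|u v] h; first last.
    rewrite !step_M3; [|by move: h => /=; msz_lia..].
    rewrite opprD -(mulrN (mev u)) -(mulrN (mev v)) -!step_swap15 //; move: h => /=; msz_lia.
  case: d h => [l|u v] h; first last.
    rewrite !step_M4; [|by move: h => /=; msz_lia..].
    rewrite opprD -(mulrN (mev u)) -(mulrN (mev v)) -!step_swap15 //; move: h => /=; msz_lia.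
  case: e h => [m|u v] h; first exact: x_swap15.
  rewrite step_M5 1?step_M1; [|by move: h => /=; msz_lia..].
  rewrite opprD -(mulrN (mev u)) -(mulrN (mev v)) -!step_swap15 //; move: h => /=; msz_lia.
- case: a => [i|u v] h; first last.
    rewrite step_M1 1?step_M3; [|by move: h => /=; msz_lia..].
    rewrite opprD -(mulrN (mev u)) -(mulrN (mev v)) -!step_swap13 //; move: h => /=; msz_lia.
  case: b h => [j|u v] h; first last.
    rewrite !step_M2; [|by move: h => /=; msz_lia..].
    rewrite opprD -(mulrN (mev u)) -(mulrN (mev v)) -!step_swap13 //; move: h => /=; msz_lia.
  case: c h => [k|u v] h; first last.
    rewrite step_M3 1?step_M1; [|by move: h => /=; msz_lia..].
    rewrite opprD -(mulrN (mev u)) -(mulrN (mev v)) -!step_swap13 //; move: h => /=; msz_lia.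
  case: d h => [l|u v] h; first last.
    rewrite !step_M4; [|by move: h => /=; msz_lia..].
    rewrite opprD -(mulrN (mev u)) -(mulrN (mev v)) -!step_swap13 //; move: h => /=; msz_lia.
  case: e h => [m|u v] h; first exact: x_swap13.
  rewrite !step_M5; [|by move: h => /=; msz_lia..].
  rewrite opprD -(mulrN (mev u)) -(mulrN (mev v)) -!step_swap13 //; move: h => /=; msz_lia.
Qed.

Lemma step_nil_at : nil_at n.
Proof.
have s15 a b c d e h := (@step_swap a b c d e h).1.
have s13 a b c d e h := (@step_swap a b c d e h).2.
have s25 a b c d e : (msz a + msz b + msz c + msz d + msz e)%N = n ->
    F a b c d e = - F a e c d b.
  move=> h; rewrite cm23_swap12 s15; last by lia.
  by rewrite [cm23 (mev e) _ _ _ _]cm23_swap12 !opprK.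
have slot1 a b c d : (msz a + msz b + msz c + msz d)%N = n ->
    (forall i, a <> Leaf i) -> cm (z a b c) (mev d) = 0.
  case: a => [i|u v] h ha; first by case: (ha i).
  (* The six [cm23] terms have degree [n] and cancel in pairs by the swaps just proved at that
     degree. *)
  have -> : cm (z (Node u v) b c) (mev d) =
     mev u * cm (z v b c) (mev d) + cm (z u b c) (mev d) * mev v
     + (F u d v b c + F u c v b d) + (F v c u b d + F v d u b c)
     + (F v b u c d + F u b v c d)
     + cm (z u c d) (y v b) + cm (z u b d) (y v c) + cm (z u b c) (y v d) by ncr.
  move: h; rewrite /= => h.
  rewrite !step_cm3_cm ?(s25 u d) ?(s25 v c) ?(s13 v b); [|by msz_lia..].
  by rewrite !step_nil ?addNr ?(mulr0, mul0r, addr0) //; msz_lia.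
have slot3 a b c d : (msz a + msz b + msz c + msz d)%N = n ->
    (forall i, c <> Leaf i) -> cm (z a b c) (mev d) = 0.
  case: c => [i|u v] h ha; first by case: (ha i).
  have -> : cm (z a b (Node u v)) (mev d) =
     mev u * cm (z a b v) (mev d) + cm (z a b u) (mev d) * mev v
     + (F u d a b v + F v d a b u) + cm (z a b u) (y v d) by ncr.
  move: h; rewrite /= => h.
  rewrite !step_cm3_cm ?(s15 u d); [|by msz_lia..].
  by rewrite !step_nil ?addNr ?(mulr0, mul0r, addr0) //; msz_lia.
have leafP a : {i | a = Leaf i} + (forall i, a <> Leaf i).
  by case: a => [i|u v]; [left; exists i|right].
move=> a b c d h.
case: (leafP a) => [[i ai]|/slot1->//].
case: (leafP b) => [[j bj]|hb].
  case: (leafP c) => [[k ck]|/slot3->//].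
  case: d h => [l|u v] h; first by rewrite ai bj ck; exact: x_nil.
  have -> : cm (z a b c) (mev (Node u v)) =
     mev u * cm (z a b c) (mev v) + cm (z a b c) (mev u) * mev v by ncr.
  by move: h; rewrite /= => h; rewrite !step_nil ?(mulr0, mul0r, addr0) //; msz_lia.
have -> : cm (z a b c) (mev d) = - cm (z b a c) (mev d) by ncr.
by rewrite slot1 ?oppr0 //; lia.
Qed.
End Step.

Lemma mev_nil a b c d : cm (z a b c) (mev d) = 0.
Proof.
have [n n_def] : {n | n = msz a + msz b + msz c + msz d}%N by eexists.
suff: [/\ nil_at n, swap_at n, alt4_at n & cm3_at n] by case=> ->.
elim/ltn_ind: n {n_def a b c d} => n IHn.
have [IHnil IHswap IHalt4 IHcm3] : [/\ forall m, (m < n)%N -> nil_at m,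
    forall m, (m < n)%N -> swap_at m, forall m, (m < n)%N -> alt4_at m &
    forall m, (m < n)%N -> cm3_at m] by split=> m /IHn[].
(* Inside degree [n] there is no circle: [step_cm3] and [step_alt4] use smaller degrees only,
   [step_swap] uses those two at degree [n], and [step_nil_at] uses [step_swap]. *)
split; [exact: step_nil_at|exact: step_swap|exact: step_alt4|exact: step_cm3].
Qed.
End Generators.

(** * Operators on forms in characteristic 3 *)

Section Model.
Variables (Q : pzRingType) (n : nat) (o : 'I_n) (th t dd : 'I_n -> Q).
Hypothesis char3 : forall a : Q, a *+ 3 = 0.
Hypothesis thA : forall i j, th i * th j = - (th j * th i).
Hypothesis tC : forall i j, t i * t j = t j * t i.
Hypothesis t_th : forall i j, t i * th j = th j * t i.
Hypothesis dd_th : forall i j, dd i * th j = th j * dd i.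
Hypothesis dd_t : forall i j, dd i * t j = t j * dd i + (i == j)%:R.

Local Notation ep := (th o).

(** The index [o] supplies eps as one more theta. The sums may run over [o] as well: behind a factor
    [ep] its terms vanish. *)
Definition Dop := \sum_j th j * dd j.
Definition rterm j k := th j * th k * (dd j * dd k).
Definition rop m := \sum_j \sum_k rterm j k *+ ((j < k) && (j < m))%N.
Definition Xop i := t i + th i + ep * th i * rop i.

(** Anticommutation kills twice the square, and 3 = 0 kills three times it. *)
Lemma thth i : th i * th i = 0.
Proof.
have := char3 (th i * th i); rewrite !mulrS {1}thA addr0.
by rewrite addrA addNr add0r.
Qed.

Lemma th_th i j a : th i * (th j * a) = - (th j * (th i * a)).
Proof. by rewrite mulrA thA mulNr mulrA. Qed.

Lemma ththC i j k : cm (th i * th j) (th k) = 0.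
Proof.
by apply/cm0P; rewrite -mulrA (thA j) mulrN mulrA (thA i) mulNr opprK mulrA.
Qed.

Lemma Dop_th i : Dop * th i = - (th i * Dop).
Proof.
rewrite mulr_suml mulr_sumr -sumrN; apply: eq_bigr => j _.
by rewrite -mulrA dd_th mulrA thA mulNr mulrA.
Qed.

Lemma Dop_t i : cm Dop (t i) = th i.
Proof.
rewrite /cm mulr_suml mulr_sumr -sumrB (bigD1 i) //= big1 ?addr0.
  rewrite -mulrA dd_t eqxx mulrDr mulr1 !mulrA (t_th i i).
  by rewrite addrAC subrr add0r.
by move=> j /negPf ji; rewrite -mulrA dd_t ji addr0 !mulrA t_th subrr.
Qed.

Lemma rop_th m i : cm (rop m) (th i) = 0.
Proof.
apply/cm0P; rewrite mulr_suml mulr_sumr; apply: eq_bigr => j _.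
rewrite mulr_suml mulr_sumr; apply: eq_bigr => k _.
rewrite mulrnAl mulrnAr; congr (_ *+ _); rewrite /rterm -!mulrA !(dd_th _ i).
rewrite (mulrA (dd j)) dd_th !mulrA; do 2 congr (_ * _).
by have /cm0P := ththC j k i; rewrite mulrA.
Qed.

Lemma rterm_t i j k : cm (rterm j k) (t i) =
  (th j * th k * dd k) *+ (j == i) + (th j * th k * dd j) *+ (k == i).
Proof.
have -> : cm (rterm j k) (t i) = th j * th k * (cm (dd j) (t i) * dd k + dd j * cm (dd k) (t i))
    + cm (th j * th k) (t i) * (dd j * dd k) by rewrite /rterm; ncr.
have -> : cm (th j * th k) (t i) = 0.
  by apply/cm0P; rewrite -mulrA -t_th mulrA -t_th mulrA.
rewrite mul0r addr0.
have ddE l : cm (dd l) (t i) = (l == i)%:R by rewrite /cm dd_t addrAC subrr add0r.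
by rewrite !ddE mulrDr mulr_natl mulr_natr !mulrnAr.
Qed.

(** Only d/dt_i fails to commute with t_i. It occurs in [rterm] as first or as second derivative;
    the second case gets its minus sign from reordering [th k * th i]. *)
Lemma rop_t m i : cm (rop m) (t i) =
  th i * \sum_k ((th k * dd k) *+ ((i < k) && (i < m))%N - (th k * dd k) *+ ((k < i) && (k < m))%N).
Proof.
have -> : cm (rop m) (t i) = \sum_j \sum_k cm (rterm j k) (t i) *+ ((j < k) && (j < m))%N.
  rewrite /cm mulr_suml mulr_sumr -sumrB; apply: eq_bigr => j _.
  rewrite mulr_suml mulr_sumr -sumrB; apply: eq_bigr => k _.
  by rewrite mulrnAl mulrnAr -mulrnBl.
under eq_bigr => j _.
  under eq_bigr => k _ do rewrite rterm_t mulrnDl.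
  rewrite big_split /=; over.
rewrite big_split /= mulr_sumr.
rewrite [X in X + _](bigD1 i) //= [X in _ + X + _]big1 ?addr0; last first.
  by move=> j /negPf ji; rewrite big1 // => k _; rewrite ji !mul0rn.
rewrite [X in _ + X]exchange_big /= [X in _ + X](bigD1 i) //=.
rewrite [X in _ + (_ + X)]big1 ?addr0; last first.
  by move=> j /negPf ji; rewrite big1 // => k _; rewrite ji !mul0rn.
rewrite -big_split /=; apply: eq_bigr => k _.
by rewrite eqxx !mulr1n mulrBr !mulrnAr !mulrA (thA k i) !mulNr mulNrn.
Qed.

Lemma rop_rel i j :
  th i * cm (rop i) (t j) - th j * cm (rop j) (t i) = th i * th j * Dop.
Proof.
rewrite !rop_t !mulrA (thA j i) mulNr opprK -mulrDr -big_split /= !mulr_sumr.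
apply: eq_bigr => k _; rewrite !mulrDr !mulrN !mulrnAr.
have [->|ki] := eqVneq k i.
  by rewrite !mulrA -(mulrA (th i)) (thA j) mulrN mulrA thth !(mul0r, mulNr, oppr0, mul0rn, addr0).
have [->|kj] := eqVneq k j.
  by rewrite !mulrA -(mulrA (th i)) thth !(mul0r, mulr0, oppr0, mul0rn, addr0).
have [->|ij] := eqVneq i j.
  by rewrite !mulrA thth !(mul0r, oppr0, mul0rn, addr0).
move: (th i * th j * _) => a; move: ki kj ij; rewrite -!(inj_eq val_inj) /=.
(* For [k] below both [i] and [j] the coefficient is -2, for every other [k] distinct from both it
   is 1. They agree since 3 = 0, which is why [rop] has this form. *)
have a2 : - a - a = a.
  by apply/esym/eqP; rewrite -opprD -addr_eq0 -(char3 a) !mulrS addr0.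
case: (ltngtP k i) => // ki _; case: (ltngtP k j) => // kj _; case: (ltngtP i j) => // ij _;
  rewrite /= ?ki ?kj ?ij ?(ltn_geF ki) ?(ltn_geF kj) ?(ltn_geF ij) /=
    ?mulr1n ?mulr0n ?oppr0 ?addr0 ?add0r ?subr0 //; try lia.
Qed.

Lemma ep_ep a : ep * (ep * a) = 0.
Proof. by rewrite mulrA thth mul0r. Qed.

Lemma t_tth i j k : cm (th i * th j) (t k) = 0.
Proof. by apply/cm0P; rewrite -mulrA -t_th mulrA -t_th mulrA. Qed.

Lemma rop_ep m a : rop m * (ep * a) = ep * (rop m * a).
Proof. by have /cm0P e := rop_th m o; rewrite mulrA e mulrA. Qed.

(* Each monomial below containing two factors [ep] vanishes. *)
Lemma Xop_cm i j : cm (Xop i) (Xop j) = (th i * th j) *+ 2 + ep * (th i * th j) * Dop.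
Proof.
have -> : cm (Xop i) (Xop j) = cm (t i) (t j) + cm (t i) (th j) - cm (t j) (th i)
   + (th i * th j - th j * th i)
   - cm (ep * th j) (t i) * rop j + cm (ep * th i) (t j) * rop i
   - cm (ep * th j) (th i) * rop j + cm (ep * th i) (th j) * rop i
   - ep * th j * cm (rop j) (th i) + ep * th i * cm (rop i) (th j)
   + ep * (th i * cm (rop i) (t j) - th j * cm (rop j) (t i))
   + (ep * th i * rop i * (ep * th j * rop j) - ep * th j * rop j * (ep * th i * rop i)).
  by rewrite /Xop; ncr.
rewrite !ththC !t_tth !rop_th rop_rel -!mulrA !rop_ep !(th_th _ o) !mulrN !ep_ep.
rewrite (thA j i) opprK.
by rewrite /cm tC !t_th !subrr !(mul0r, mulr0, oppr0, subr0, addr0, add0r) mulrA mulr2n.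
Qed.

(** The even product [th i * th j] commutes with [Xop k], [Dop] anticommutes with the thetas, and
    two factors [ep] give 0. What survives is [cm Dop (t k) = th k]. *)
Lemma Xop_cm3 i j k : cm3 (Xop i) (Xop j) (Xop k) = ep * (th i * th j * th k).
Proof.
rewrite /cm3 Xop_cm mulr2n.
have -> : cm (th i * th j + th i * th j + ep * (th i * th j) * Dop) (Xop k) =
  (1 + 1) * (cm (th i * th j) (t k) + cm (th i * th j) (th k)
    + ep * cm (th i * th j) (th k) * rop k + cm (th i * th j) ep * th k * rop k
    + ep * th k * cm (th i * th j) (rop k))
  + ep * (th i * th j) * cm Dop (t k) + cm (ep * (th i * th j)) (t k) * Dop
  + ep * (th i * th j) * (Dop * th k + th k * Dop)
  - (ep * cm (th i * th j) (th k) + (ep * th k + th k * ep) * (th i * th j)) * Dop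
  + ep * (th i * th j) * Dop * (ep * th k * rop k)
  - ep * th k * rop k * (ep * (th i * th j) * Dop) by rewrite /Xop; ncr.
rewrite ththC !t_tth (ththC i j o) Dop_t Dop_th addNr (thA k o) addrN.
have -> : cm (th i * th j) (rop k) = - (cm (rop k) (th i) * th j + th i * cm (rop k) (th j)).
  by ncr.
have -> : cm (ep * (th i * th j)) (t k) = cm ep (t k) * (th i * th j) + ep * cm (th i * th j) (t k).
  by ncr.
have -> : ep * (th i * th j) * Dop * (ep * th k * rop k) = 0.
  rewrite -!mulrA (mulrA Dop) Dop_th mulNr !mulrN -(mulrA ep) (th_th j) mulrN (th_th i) !mulrN.
  by rewrite ep_ep !oppr0.
have -> : ep * th k * rop k * (ep * (th i * th j) * Dop) = 0.
  by rewrite -!mulrA rop_ep (th_th k) mulrN ep_ep oppr0.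
rewrite !rop_th t_tth /cm t_th subrr.
by rewrite !(mul0r, mulr0, oppr0, subr0, addr0, add0r) !mulrA.
Qed.

Lemma ep_tth i j k a : ep * (th i * th j * th k) * (ep * a) = 0.
Proof.
by rewrite -!mulrA (th_th k) !mulrN (th_th j) !mulrN (th_th i) !mulrN ep_ep !oppr0.
Qed.

(** A product of four thetas commutes with every t and theta, and its factor [ep] kills the last
    term of [Xop l]. *)
Lemma Xop_nil i j k l : cm (cm3 (Xop i) (Xop j) (Xop k)) (Xop l) = 0.
Proof.
rewrite Xop_cm3; set A := th i * th j; set B := th k.
have -> : cm (ep * (A * B)) (Xop l) =
  cm ep (t l) * (A * B) + ep * (cm A (t l) * B) + ep * A * cm B (t l)
  + (ep * A * (B * th l + th l * B) - ep * cm A (th l) * B - (ep * th l + th l * ep) * (A * B))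
  + ep * (A * B) * (ep * (th l * rop l)) - ep * (th l * (rop l * (ep * (A * B)))).
  by rewrite /Xop; ncr.
rewrite ep_tth rop_ep (th_th l) mulrN ep_ep /A /B t_tth ththC (thA k l) (thA l o).
by rewrite /cm !t_th !subrr ?addNr ?subrr !(mul0r, mulr0, oppr0, subr0, addr0, add0r).
Qed.

Lemma Xop_cm3_cm3 i j k l m p :
  cm3 (Xop i) (Xop j) (Xop k) * cm3 (Xop l) (Xop m) (Xop p) = 0.
Proof. by rewrite !Xop_cm3 ep_tth. Qed.

(** On multiples of [ep] the eps part of the commutator dies. *)
Lemma Xop_cm_ep i j a :
  cm (Xop i) (Xop j) * (ep * a) = ep * (th i * (th j * a)) *+ 2.
Proof.
rewrite Xop_cm mulrDl.
have -> : ep * (th i * th j) * Dop * (ep * a) = 0.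
  rewrite -!mulrA (mulrA Dop) Dop_th mulNr !mulrN -(mulrA ep) (th_th j) mulrN.
  by rewrite (th_th i) !mulrN ep_ep !oppr0.
by rewrite addr0 mulrnAl -!mulrA (th_th j) mulrN (th_th i) opprK.
Qed.

Lemma Xop_cm23 i j k l m : cm23 (Xop i) (Xop j) (Xop k) (Xop l) (Xop m) =
  ep * (th i * (th j * (th k * (th l * th m)))) *+ 2.
Proof. by rewrite /cm23 Xop_cm3 -!mulrA Xop_cm_ep. Qed.

Lemma Xop_swap13 i j k l m :
  cm23 (Xop i) (Xop j) (Xop k) (Xop l) (Xop m) =
  - cm23 (Xop k) (Xop j) (Xop i) (Xop l) (Xop m).
Proof.
rewrite !Xop_cm23 (th_th j k) mulrN (th_th i k) opprK (th_th i j) !mulrN.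
by rewrite mulNrn.
Qed.

Lemma Xop_swap15 i j k l m :
  cm23 (Xop i) (Xop j) (Xop k) (Xop l) (Xop m) =
  - cm23 (Xop m) (Xop j) (Xop k) (Xop l) (Xop i).
Proof.
have E a b c d f : cm23 (Xop a) (Xop b) (Xop c) (Xop d) (Xop f) =
    - cm23 (Xop a) (Xop b) (Xop f) (Xop d) (Xop c).
  rewrite !Xop_cm23 (thA d f) mulrN (th_th c f) opprK (thA c d) !mulrN.
  by rewrite mulNrn.
by rewrite E Xop_swap13 E !opprK.
Qed.

(** The first factor already vanishes: a product of two commutators is 4 times [A + ep * A * Dop],
    with [A] the product of the four thetas, hence alternating. *)
Lemma Xop_alt4 i j k l m p :
  alt4 (Xop i) (Xop j) (Xop k) (Xop l) (Xop m) (Xop p) = 0.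
Proof.
rewrite /alt4; have -> : cm (Xop i) (Xop j) * cm (Xop k) (Xop l)
  + cm (Xop i) (Xop k) * cm (Xop j) (Xop l) = 0; last by rewrite mul0r.
have E a b c d : cm (Xop a) (Xop b) * cm (Xop c) (Xop d) =
    (th a * th b * th c * th d + ep * (th a * th b * th c * th d) * Dop) *+ 4.
  have DB : Dop * (th c * th d) = th c * th d * Dop.
    by rewrite mulrA Dop_th mulNr -mulrA Dop_th mulrN opprK mulrA.
  rewrite [cm (Xop c) _]Xop_cm mulrDr -(mulrA ep) Xop_cm_ep mulrnAr Xop_cm mulrDl mulrnAl.
  rewrite -(mulrA _ Dop) DB !mulrA .
  have G (u v : Q) : (u *+ 2 + v) *+ 2 + v *+ 2 = (u + v) *+ 4.
    by rewrite !mulrS !mulr0n; ncr.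
  exact: G.
have R a b c d : th a * th b * th c * th d = - (th a * th c * th b * th d).
  by rewrite -(mulrA (th a)) (thA b) mulrN mulNr mulrA.
by rewrite !E -mulrnDl (R _ j) mulrN mulNr addrACA !addNr addr0 mul0rn.
Qed.

End Model.

(** * The ring of additive endomorphisms of an abelian group *)

Section Endomorphisms.
Variable V : zmodType.

Record endo := Endo {
  endo_fun :> V -> V;
  endoD : {morph endo_fun : u v / u + v} }.

HB.instance Definition _ := gen_eqMixin endo.
HB.instance Definition _ := gen_choiceMixin endo.

Lemma endoP (f g : endo) : f =1 g -> f = g.
Proof.
case: f g => [f fD] [g gD] /= /funext fg; rewrite -fg in gD *.
by rewrite (Prop_irrelevance fD gD).
Qed.

Lemma endo0D : {morph (fun=> 0) : u v / u + v :> V}.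
Proof. by move=> u v; rewrite addr0. Qed.
Lemma endoND (f : endo) : {morph (fun u => - f u) : u v / u + v}.
Proof. by move=> u v; rewrite endoD opprD. Qed.
Lemma endoDD (f g : endo) : {morph (fun u => f u + g u) : u v / u + v}.
Proof. by move=> u v; rewrite !endoD addrACA. Qed.
Lemma endo1D : {morph (fun u : V => u) : u v / u + v}.
Proof. by []. Qed.
Lemma endoMD (f g : endo) : {morph (fun u => f (g u)) : u v / u + v}.
Proof. by move=> u v; rewrite !endoD. Qed.

Lemma endo_addA : associative (fun f g => Endo (endoDD f g)).
Proof. by move=> f g h; apply: endoP => u /=; rewrite addrA. Qed.
Lemma endo_addC : commutative (fun f g => Endo (endoDD f g)).
Proof. by move=> f g; apply: endoP => u /=; rewrite addrC. Qed.
Lemma endo_add0 : left_id (Endo endo0D) (fun f g => Endo (endoDD f g)).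
Proof. by move=> f; apply: endoP => u /=; rewrite add0r. Qed.
Lemma endo_addN :
  left_inverse (Endo endo0D) (fun f => Endo (endoND f)) (fun f g => Endo (endoDD f g)).
Proof. by move=> f; apply: endoP => u /=; rewrite addNr. Qed.
Lemma endo_mulA : associative (fun f g => Endo (endoMD f g)).
Proof. by move=> f g h; apply: endoP. Qed.
Lemma endo_mul1 : left_id (Endo endo1D) (fun f g => Endo (endoMD f g)).
Proof. by move=> f; apply: endoP. Qed.
Lemma endo_mulr1 : right_id (Endo endo1D) (fun f g => Endo (endoMD f g)).
Proof. by move=> f; apply: endoP. Qed.
Lemma endo_mulDl :
  left_distributive (fun f g => Endo (endoMD f g)) (fun f g => Endo (endoDD f g)).
Proof. by move=> f g h; apply: endoP. Qed.
Lemma endo_mulDr :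
  right_distributive (fun f g => Endo (endoMD f g)) (fun f g => Endo (endoDD f g)).
Proof. by move=> f g h; apply: endoP => u /=; rewrite endoD. Qed.

HB.instance Definition _ := GRing.isPzRing.Build endo
  endo_addA endo_addC endo_add0 endo_addN
  endo_mulA endo_mul1 endo_mulr1 endo_mulDl endo_mulDr.

Lemma endo0E u : (0 : endo) u = 0. Proof. by []. Qed.
Lemma endo1E u : (1 : endo) u = u. Proof. by []. Qed.
Lemma endo_addE (f g : endo) u : (f + g) u = f u + g u. Proof. by []. Qed.
Lemma endo_mulE (f g : endo) u : (f * g) u = f (g u). Proof. by []. Qed.
Lemma endo_natE (f : endo) u n : (f *+ n) u = f u *+ n.
Proof. by elim: n => [|n IHn]; rewrite ?mulr0n // !mulrS endo_addE IHn. Qed.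
End Endomorphisms.

(* Formal series with F_3 coefficients in the commuting t_i and the
   anticommuting theta_i; a coefficient is indexed by the exponents of the t_i
   and the set of the theta_i that occur. *)
Section Forms.
Variable N : nat.

Definition form_index : Type := {ffun 'I_N.+1 -> nat} * {set 'I_N.+1}.
Definition form : Type := form_index -> 'F_3.
HB.instance Definition _ := GRing.Zmodule.on form.

(** In multiplication by t_i or theta_i and in d/dt_i, each coefficient of the image is a scalar
    times one coefficient of the argument. Relations thus reduce to comparing scalars and index
    maps. *)
Definition pull_fun (k : form_index -> 'F_3) (g : form_index -> form_index)
  (f : form) : form := fun c => k c * f (g c).

Lemma pull_funD k g : {morph pull_fun k g : u v / u + v}.
Proof. by move=> u v; apply/funext => c; rewrite /pull_fun mulrDr. Qed.

Definition pull k g : endo form := Endo (pull_funD k g).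

Lemma pullE k g f c : pull k g f c = k c * f (g c). Proof. by []. Qed.

Lemma pullM k g k' g' :
  pull k g * pull k' g' = pull (fun c => k c * k' (g c)) (fun c => g' (g c)).
Proof. by apply: endoP => f; apply/funext => c; rewrite endo_mulE !pullE mulrA. Qed.

Lemma pullN k g : - pull k g = pull (fun c => - k c) g.
Proof. by apply: endoP => f; apply/funext => c; rewrite !pullE mulNr. Qed.

Lemma eq_pull k g k' g' :
  (forall c, k c = k' c) -> (forall c, k c != 0 -> g c = g' c) ->
  pull k g = pull k' g'.
Proof.
move=> kk' gg'; apply: endoP => f; apply/funext => c; rewrite !pullE -kk'.
by have [->|/gg'->//] := eqVneq (k c) 0; rewrite !mul0r.
Qed.

Implicit Types (i j : 'I_N.+1) (a : {ffun 'I_N.+1 -> nat}) (S : {set 'I_N.+1}).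

Definition incr i a := [ffun j => (a j + (i == j))%N] : {ffun 'I_N.+1 -> nat}.
Definition decr i a := [ffun j => (a j - (i == j))%N] : {ffun 'I_N.+1 -> nat}.
(** The sign of moving theta_i from the front to its place in the increasing product over [S]. *)
Definition sgn i S : 'F_3 := (-1) ^+ #|[set j in S | (j < i)%N]|.

Definition theta i := pull (fun c => (i \in c.2)%:R * sgn i c.2) (fun c => (c.1, c.2 :\ i)).
(** The weight discards exponent 0, where the subtraction in [decr] is truncated. *)
Definition tvar i := pull (fun c => (0 < c.1 i)%N%:R) (fun c => (decr i c.1, c.2)).
Definition dvar i := pull (fun c => (c.1 i).+1%:R) (fun c => (incr i c.1, c.2)).

Lemma F3_mul3 (u : 'F_3) : u *+ 3 = 0.
Proof. by case: u => -[|[|[|]]] //= h; apply: val_inj. Qed.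

Lemma form_char3 (A : endo form) : A *+ 3 = 0.
Proof.
apply: endoP => f; apply/funext => c; rewrite endo_natE.
by rewrite -[RHS](F3_mul3 (A f c)) !mulrS !mulr0n.
Qed.

Lemma sgnD1 i j S : i \in S -> sgn j (S :\ i) = if (i < j)%N then - sgn j S else sgn j S.
Proof.
move=> iS; rewrite /sgn; case: ifP => ij.
  have -> : [set k in S | (k < j)%N] = i |: [set k in S :\ i | (k < j)%N].
    by apply/setP => k; rewrite !inE; case: eqP => // ->; rewrite iS ij.
  by rewrite cardsU1 !inE eqxx /= add1n exprS mulN1r opprK.
congr (_ ^+ _); apply: eq_card => k.
by rewrite !inE; case: eqP => [->|_] /=; rewrite ?ij ?andbF.
Qed.

Lemma theta_anti i j : theta i * theta j = - (theta j * theta i).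
Proof.
rewrite !pullM pullN; apply: eq_pull => [[a S]|[a S]] /=; last first.
  by rewrite !setDDl setUC.
rewrite !inE eq_sym; have [->|ji] := eqVneq i j; first by rewrite !mul0r !mulr0 oppr0.
rewrite /=; case iS: (i \in S); last by rewrite !(mul0r, mulr0, oppr0).
case jS: (j \in S); last by rewrite !(mul0r, mulr0, oppr0).
rewrite !mul1r !sgnD1 //.
move: ji; rewrite -(inj_eq val_inj) /=; case: ltngtP => //= _ _.
  by rewrite mulrN mulrC.
by rewrite mulrN opprK mulrC.
Qed.

Lemma tvarC i j : tvar i * tvar j = tvar j * tvar i.
Proof.
rewrite !pullM; apply: eq_pull => [[a S]|[a S]] /=.
  rewrite !ffunE eq_sym; have [->//|ij] := eqVneq i j; by rewrite !subn0 mulrC.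
by move=> _; congr (_, _); apply/ffunP => k; rewrite !ffunE subnAC.
Qed.

Lemma tvar_theta i j : tvar i * theta j = theta j * tvar i.
Proof. by rewrite !pullM; apply: eq_pull => -[a S] //=; rewrite mulrC. Qed.

Lemma dvar_theta i j : dvar i * theta j = theta j * dvar i.
Proof. by rewrite !pullM; apply: eq_pull => -[a S] //=; rewrite mulrC. Qed.

Lemma dvar_tvar i j : dvar i * tvar j = tvar j * dvar i + (i == j)%:R.
Proof.
apply: endoP => f; apply/funext => -[a S].
rewrite endo_addE !endo_mulE /=.
have -> : ((i == j)%:R : endo form) f = f *+ (i == j) by case: eqP.
have addE (u v : form) c : (u + v) c = u c + v c by [].
rewrite addE /dvar /tvar /= /pull_fun /= !ffunE.
have [->|ij] := eqVneq i j; last first.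
  have -> : (f *+ false) (a, S) = 0 by [].
  rewrite /= addn0 subn0 addr0 !mulrA [_ * _%:R]mulrC.
  congr (_ * f (_, _)); apply/ffunP => k; rewrite !ffunE.
  by move: ij; case: (eqVneq i k) => [->|]; case: (eqVneq j k) => //= *; lia.
rewrite /= addn1 ltnS leq0n mul1r mulr1n.
have -> : decr j (incr j a) = a by apply/ffunP => k; rewrite !ffunE addnK.
case: posnP => [->|aj]; first by rewrite mul1r mul0r add0r.
have -> : incr j (decr j a) = a.
  by apply/ffunP => k; rewrite !ffunE; case: eqP => [<-|_] /=; lia.
rewrite mul1r -[X in _ + X]mul1r -mulrDl -natr1; congr ((_ + _) * _).
by congr (_%:R); lia.
Qed.
End Forms.

(** * Linear independence of E *)

(** Subtraction yields negatives and sums, hence all integer multiples of words. *)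
Lemma ZX_ind (P : ZX -> Prop) :
  P 0 -> (forall f g, P f -> P g -> P (f - g)) -> (forall w : word, P << w >>) ->
  forall f, P f.
Proof.
move=> P0 PB Pw f.
have PD f1 f2 : P f1 -> P f2 -> P (f1 + f2).
  by move=> P1 P2; rewrite -[f2]opprK -[- f2]sub0r; apply: (PB) => //; apply: (PB).
rewrite [f]monalgE; elim/big_ind: _ => // w _.
have Pn (n : nat) : P << n%:Z *g w >>.
  elim: n => [|n IHn]; first by rewrite monalgU0.
  by rewrite intS monalgUD; apply: PD.
case: (f@_w) => n; first exact: Pn.
by rewrite NegzE monalgUN -sub0r; apply: PB.
Qed.

(** * Evaluation of the free ring at a sequence of ring elements *)

Section FreeRing.
Variables (Q : nzRingType) (x : nat -> Q).

Definition word_eval (w : word) : Q := \prod_(i <- w) x i.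

Lemma word_eval_mmorphism : mmorphism word_eval.
Proof. by split=> [u v|]; rewrite /word_eval ?big_cat ?big_nil. Qed.

HB.instance Definition _ := isMultiplicative.Build word Q word_eval word_eval_mmorphism.

Definition free_eval (f : ZX) : Q := mmap (intmul 1) word_eval f.

Lemma free_eval_is_zmod_morphism : zmod_morphism free_eval.
Proof. exact: mmap_is_additive. Qed.

Lemma free_eval_is_monoid_morphism : monoid_morphism free_eval.
Proof.
have h (f : ZX) m m' : GRing.comm (intmul 1 f@_m) (word_eval m').
  by apply: commr_sym; exact: commr_int.
by have [e1 e2] := commr_mmap_is_multiplicative h; split.
Qed.

HB.instance Definition _ :=
  GRing.isZmodMorphism.Build ZX Q free_eval free_eval_is_zmod_morphism.
HB.instance Definition _ :=
  GRing.isMonoidMorphism.Build ZX Q free_eval free_eval_is_monoid_morphism.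

Lemma free_eval_word w : free_eval << w >> = word_eval w.
Proof. by rewrite /free_eval mmapU mul1r. Qed.

Lemma free_eval_xvar i : free_eval (xvar i) = x i.
Proof. by rewrite free_eval_word /word_eval big_seq1. Qed.

Lemma free_eval_comm f g : free_eval (comm f g) = cm (free_eval f) (free_eval g).
Proof. by rewrite rmorphB !rmorphM. Qed.

Hypothesis mev_nil_x : forall a b c d,
  cm (cm3 (mev x a) (mev x b) (mev x c)) (mev x d) = 0.

Lemma word_eval_mev i w : exists a, word_eval (i :: w) = mev x a.
Proof.
elim: w i => [|j w IHw] i; first by exists (Leaf i); rewrite /word_eval big_seq1.
by have [a aE] := IHw j; exists (Node (Leaf i) a); rewrite /= -aE /word_eval big_cons.
Qed.

Lemma free_eval_nil f1 f2 f3 f4 :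
  cm (cm3 (free_eval f1) (free_eval f2) (free_eval f3)) (free_eval f4) = 0.
Proof.
(* Arguments are extended one at a time from monomials to the whole image. The condition [D 1 = 0]
   covers the empty word, which no [mag] represents. *)
have ext (D : Q -> Q) : (forall u v, D (u - v) = D u - D v) -> D 1 = 0 ->
    (forall a, D (mev x a) = 0) -> forall f, D (free_eval f) = 0.
  move=> DB D1 Da; elim/ZX_ind => [|f g Df Dg|[|i w]].
  - by rewrite rmorph0 -(subrr 1) DB !subrr.
  - by rewrite rmorphB DB Df Dg subrr.
  - by rewrite free_eval_word /word_eval big_nil D1.
  - by rewrite free_eval_word; have [a ->] := word_eval_mev i w; exact: Da.
apply: (ext (fun q => cm (cm3 q _ _) _)) => [u v||a]; [by ncr..|].
apply: (ext (fun q => cm (cm3 _ q _) _)) => [u v||b]; [by ncr..|].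
apply: (ext (fun q => cm (cm3 _ _ q) _)) => [u v||c]; [by ncr..|].
by apply: (ext (fun q => cm (cm3 _ _ _) q)) => [u v||d]; [ncr|ncr|].
Qed.

Lemma free_eval_T4 f : T4 f -> free_eval f = 0.
Proof.
case=> n [u [v [s [gs ->]]]]; rewrite rmorph_sum big1 // => i _.
rewrite !rmorphM; have [a [b [c [d ->]]]] := gs i.
by rewrite /= /comm4 /comm3 !free_eval_comm [cm (cm _ _) _]free_eval_nil mulr0 mul0r.
Qed.
End FreeRing.

Lemma prod_nat_pairs (Q : pzRingType) (k : nat) (g : nat -> Q) :
  \prod_(t < k) (g (2 * t)%N * g (2 * t).+1) = \prod_(0 <= i < 2 * k) g i.
Proof.
elim: k => [|k IHk]; first by rewrite big_ord0 big_nil.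
rewrite big_ord_recr IHk /= mulnS add2n !big_nat_recr //=.
by rewrite mulrA.
Qed.

Lemma prod_pairs_triple (Q : pzRingType) (g : nat -> Q) (ids : seq nat) k :
  size ids = (2 * k + 3)%N ->
  \prod_(t < k) (g (nth 0%N ids (2 * t)) * g (nth 0%N ids (2 * t).+1)) *
  (g (nth 0%N ids (2 * k)) * g (nth 0%N ids (2 * k).+1) * g (nth 0%N ids (2 * k).+2))
  = \prod_(i <- ids) g i.
Proof.
move=> sz; rewrite (prod_nat_pairs k (fun i => g (nth 0%N ids i))).
rewrite [RHS](big_nth 0%N) sz addn3 !big_nat_recr //=.
by rewrite !mulrA.
Qed.

(** * The elements of E as operators on forms *)

Section Independence.
Variable N : nat.

(** The constant form 1. *)
Definition vacuum : form N := fun c => (c == ([ffun=> 0%N], set0))%:R.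

Lemma endo_form_oner_neq0 : (1 : endo (form N)) != 0.
Proof.
apply/eqP => /(congr1 (fun A : endo (form N) => A vacuum ([ffun=> 0%N], set0))).
rewrite endo1E endo0E /vacuum eqxx => h.
by have /eqP := h.
Qed.

HB.instance Definition _ :=
  GRing.PzSemiRing_isNonZero.Build (endo (form N)) endo_form_oner_neq0.

Local Notation theta := (@theta N).
Local Notation tvar := (@tvar N).
Local Notation dvar := (@dvar N).
Local Notation ep := (theta ord0).

(** Variables are shifted by one since index 0 is eps. For [i >= N], [inord] returns index 0, for
    which the relations hold too. *)
Definition Xform (i : nat) : endo (form N) := Xop ord0 theta tvar dvar (inord i.+1).

Ltac form_relations := first [exact: form_char3 | exact: theta_anti | exact: tvarC
  | exact: tvar_theta | exact: dvar_theta | exact: dvar_tvar].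

Lemma Xform_T4 f : T4 f -> free_eval Xform f = 0.
Proof.
apply: free_eval_T4; apply: mev_nil => *;
  [apply: Xop_nil|apply: Xop_swap15|apply: Xop_swap13|apply: Xop_alt4|apply: Xop_cm3_cm3];
  form_relations.
Qed.

Lemma Xform_pairs (ids : seq nat) k (A : endo (form N)) :
  \prod_(t < k) cm (Xform (nth 0%N ids (2 * t))) (Xform (nth 0%N ids (2 * t).+1)) * (ep * A)
  = ep * (\prod_(t < k) (theta (inord (nth 0%N ids (2 * t)).+1)
                         * theta (inord (nth 0%N ids (2 * t).+1).+1)) * A) *+ 2 ^ k.
Proof.
elim: k A => [|k IHk] A; first by rewrite !big_ord0 !mul1r.
rewrite !big_ord_recr /= -mulrA.
rewrite Xop_cm_ep; [|form_relations..].
by rewrite mulrnAr IHk -mulrnA -expnSr !mulrA.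
Qed.

(** The eps term of x_i vanishes on multiples of [ep], and moving theta_i past [ep] changes its
    sign. *)
Lemma Xform_ep i (A : endo (form N)) :
  Xform i * (ep * A) = ep * ((tvar (inord i.+1) - theta (inord i.+1)) * A).
Proof.
rewrite /Xform /Xop !mulrDl; set j := inord _.
have -> : ep * theta j * rop theta dvar j * (ep * A) = 0.
  rewrite -!mulrA rop_ep; [|form_relations..].
  rewrite (th_th (@theta_anti N) j) mulrN.
  by rewrite mulrA (thth (@form_char3 N) (@theta_anti N)) mul0r oppr0.
by rewrite addr0 mulNr mulrDr mulrN !mulrA tvar_theta (theta_anti j) mulNr.
Qed.

Lemma Xform_prefix (js : seq nat) (A : endo (form N)) :
  \prod_(j <- js) Xform j * (ep * A) =
  ep * (\prod_(j <- js) (tvar (inord j.+1) - theta (inord j.+1)) * A).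
Proof.
elim: js => [|j js IHjs]; first by rewrite !big_nil !mul1r.
by rewrite !big_cons -mulrA IHjs Xform_ep !mulrA.
Qed.

Lemma free_eval_Eelt js ids k : size ids = (2 * k + 3)%N ->
  free_eval Xform (Eelt js ids k) =
  ep * (\prod_(j <- js) (tvar (inord j.+1) - theta (inord j.+1)) *
        \prod_(i <- ids) theta (inord i.+1)) *+ 2 ^ k.
Proof.
move=> sz; rewrite !rmorphM !rmorph_prod /= /comm3 !free_eval_comm.
under eq_bigr => j _ do rewrite free_eval_xvar.
under [X in _ * X * _]eq_bigr => t _ do rewrite free_eval_comm !free_eval_xvar.
rewrite !free_eval_xvar -/(cm3 _ _ _).
rewrite Xop_cm3; [|form_relations..].
rewrite -mulrA Xform_pairs mulrnAr Xform_prefix.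
by rewrite (prod_pairs_triple (fun i => theta (inord i.+1))).
Qed.

End Independence.

(** * Leading coefficients of operators applied to the constant form *)

Section Vacuum.
Variable N : nat.
Local Notation theta := (@theta N).
Local Notation tvar := (@tvar N).
Local Notation vacuum := (@vacuum N).
Implicit Types (l J : seq 'I_N.+1) (a : {ffun 'I_N.+1 -> nat}) (S T : {set 'I_N.+1}).

Lemma theta_prod_vacuum l : sorted (fun i j : 'I_N.+1 => i < j)%N l ->
  (\prod_(i <- l) theta i) vacuum = fun c => (c == ([ffun=> 0%N], [set i in l]))%:R.
Proof.
elim: l => [|i l IHl] /=.
  by move=> _; rewrite big_nil endo1E; apply/funext => c; rewrite /vacuum set_nil.
rewrite path_sortedE; last by move=> ? ? ?; exact: ltn_trans.
case/andP => /allP il /IHl {}IHl; rewrite big_cons endo_mulE IHl.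
apply/funext => -[a S] /=; rewrite /pull_fun /= !xpair_eqE.
case: eqP => _ /=; last by rewrite mulr0.
have il' : i \notin [set j in l].
  by rewrite inE; apply/negP => /il; rewrite ltnn.
case iS: (i \in S); last first.
  rewrite !mul0r; case: eqP => // SE.
  by move: iS; rewrite SE inE mem_head.
have -> : (S :\ i == [set j in l]) = (S == [set j in i :: l]).
  rewrite set_cons; apply/eqP/eqP => [<-|->]; first by rewrite setD1K.
  by rewrite setU1K.
case: eqP => [SE|]; last by rewrite mulr0.
(* The list increases, so no index of [S] lies below [i] and the sign is 1. *)
rewrite mul1r mulr1 /sgn (_ : [set j in S | (j < i)%N] = set0) ?cards0 //.
apply/setP => j; rewrite SE !inE; case: eqP => [->|_] /=; first by rewrite ltnn.
by case jl: (j \in l) => //=; rewrite ltnNge ltnW ?il.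
Qed.

Definition content J : {ffun 'I_N.+1 -> nat} := [ffun i => count_mem i J].

(** Neither t_j nor theta_j removes a theta from a term. *)
Lemma prefix_support T J (f : form N) :
  (forall a S, f (a, S) != 0 -> T \subset S) ->
  forall a S, (\prod_(j <- J) (tvar j - theta j)) f (a, S) != 0 -> T \subset S.
Proof.
move=> fT; elim: J => [|j J IHJ] a S; first by rewrite big_nil; exact: fT.
rewrite big_cons endo_mulE; set g := (\prod_(i <- J) (tvar i - theta i)) f in IHJ *.
have -> : (tvar j - theta j) g (a, S) =
  (0 < a j)%N%:R * g (decr j a, S) - (j \in S)%:R * sgn j S * g (a, S :\ j) by [].
have [z1|/IHJ//] := eqVneq (g (decr j a, S)) 0.
have [z2|/IHJ TS _] := eqVneq (g (a, S :\ j)) 0; first by rewrite z1 z2 !mulr0 subrr eqxx.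
by apply: subset_trans TS _; exact: subD1set.
Qed.

(** A contribution of theta_j would come from a term supported on [T :\ j], which does not contain
    [T] when [j] is in [T]. So only the t_j count. *)
Lemma prefix_coef T J (f : form N) :
  (forall a S, f (a, S) != 0 -> T \subset S) ->
  (forall a, f (a, T) = (a == [ffun=> 0%N])%:R) ->
  forall a, (\prod_(j <- J) (tvar j - theta j)) f (a, T) = (a == content J)%:R.
Proof.
move=> fT f0; elim: J => [|j J IHJ] a.
  by rewrite big_nil endo1E f0; congr (_ == _)%:R; apply/ffunP => i; rewrite !ffunE.
have sT := @prefix_support T J f fT.
rewrite big_cons endo_mulE; set g := (\prod_(i <- J) (tvar i - theta i)) f in IHJ sT *.
have -> : (tvar j - theta j) g (a, T) =
  (0 < a j)%N%:R * g (decr j a, T) - (j \in T)%:R * sgn j T * g (a, T :\ j) by [].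
have -> : (j \in T)%:R * sgn j T * g (a, T :\ j) = 0.
  case jT: (j \in T); last by rewrite !mul0r.
  have [->|/sT] := eqVneq (g (a, T :\ j)) 0; first by rewrite mulr0.
  by move/subsetP/(_ j jT); rewrite !inE eqxx.
rewrite subr0 IHJ; case: posnP => aj.
  rewrite mul0r; case: eqP => // aE; move: aj; rewrite aE !ffunE /= eqxx.
  by rewrite add1n.
rewrite mul1r; congr (_%:R); congr nat_of_bool; apply/eqP/eqP => [aE|->].
  apply/ffunP => i; move/ffunP/(_ i): aE; rewrite !ffunE /=.
  by case: eqP => [<-|_] /=; lia.
by apply/ffunP => i; rewrite !ffunE /= addnC addnK.
Qed.

Lemma ep_coef (f : form N) a T : ord0 \notin T ->
  theta ord0 f (a, ord0 |: T) = f (a, T).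
Proof.
move=> oT; rewrite /= /pull_fun /= setU11 setU1K // mul1r /sgn.
rewrite (_ : [set j in _ | _] = set0) ?cards0 ?mul1r //.
by apply/setP => j; rewrite !inE andbF.
Qed.

End Vacuum.

Section Coefficients.
Variables (N : nat) (p : form_index N).

Definition vac_coef (A : endo (form N)) : 'F_3 := A (@vacuum N) p.

Lemma vac_coef_is_zmod_morphism : zmod_morphism vac_coef.
Proof. by []. Qed.

HB.instance Definition _ :=
  GRing.isZmodMorphism.Build (endo (form N)) 'F_3 vac_coef vac_coef_is_zmod_morphism.
End Coefficients.

Lemma point_support N (T : {set 'I_N.+1}) (b : {ffun 'I_N.+1 -> nat}) S :
  ((b, S) == ([ffun=> 0%N], T))%:R != 0 :> 'F_3 -> T \subset S.
Proof. by have [[_ ->]|_] := eqVneq (b, S) ([ffun=> 0%N], T); rewrite ?eqxx. Qed.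

Section EeltCoefficients.
Variable N : nat.
Let idx (i : nat) : 'I_N.+1 := inord i.+1.

Definition idset (ids : seq nat) : {set 'I_N.+1} := [set i in map idx ids].

Variables (js ids : seq nat) (k : nat).
Implicit Types (a : {ffun 'I_N.+1 -> nat}) (T : {set 'I_N.+1}).
Hypothesis sz : size ids = (2 * k + 3)%N.
Hypothesis ids_lt : sorted ltn ids.
Hypothesis ids_N : forall i, i \in ids -> (i < N)%N.

Lemma idset0 : ord0 \notin idset ids.
Proof.
rewrite inE; apply/mapP => -[i /ids_N iN /(congr1 val)] /=.
by rewrite inordK.
Qed.

Lemma sorted_idx : sorted (fun i j : 'I_N.+1 => i < j)%N (map idx ids).
Proof.
rewrite sorted_map; apply: (@sub_in_sorted _ [in ids] ltn) ids_lt; last exact/allP.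
by move=> i j /ids_N iN /ids_N jN; rewrite /= /idx !inordK.
Qed.

Lemma Eelt_vac_coef a T : ord0 \notin T ->
  vac_coef (a, ord0 |: T) (free_eval (@Xform N) (Eelt js ids k)) =
  ((\prod_(j <- map idx js) (tvar j - theta j))
     (fun c => (c == ([ffun=> 0%N], idset ids))%:R)) (a, T) *+ 2 ^ k.
Proof.
move=> oT; rewrite free_eval_Eelt //.
have E (A B : endo (form N)) m : vac_coef (a, ord0 |: T) (theta ord0 * (A * B) *+ m) =
    A (B (@vacuum N)) (a, T) *+ m.
  by rewrite raddfMn /vac_coef; congr (_ *+ _); rewrite -(ep_coef _ _ oT).
by rewrite E -(theta_prod_vacuum sorted_idx) !big_map.
Qed.

Lemma Eelt_vac_coef_neq0 a T : ord0 \notin T ->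
  vac_coef (a, ord0 |: T) (free_eval (@Xform N) (Eelt js ids k)) != 0 ->
  idset ids \subset T.
Proof.
move=> oT; rewrite Eelt_vac_coef // => h.
apply: (@prefix_support N _ (map idx js) (fun c => (c == ([ffun=> 0%N], idset ids))%:R) _ a).
  exact: point_support.
by apply: contra_neq h => ->; rewrite mul0rn.
Qed.

Lemma Eelt_vac_coef_id a :
  vac_coef (a, ord0 |: idset ids) (free_eval (@Xform N) (Eelt js ids k)) =
  (a == content (map idx js))%:R *+ 2 ^ k.
Proof.
rewrite Eelt_vac_coef ?idset0 // prefix_coef //.
- exact: point_support.
- by move=> b; rewrite xpair_eqE eqxx andbT.
Qed.

Lemma card_idset : #|idset ids| = size ids.
Proof.
rewrite cardsE; have /card_uniqP -> : uniq (map idx ids); last by rewrite size_map.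
rewrite map_inj_in_uniq; first exact: sorted_uniq ltn_trans ltnn _ ids_lt.
by move=> i j /ids_N iN /ids_N jN /(congr1 val) /=; rewrite !inordK // => -[].
Qed.
End EeltCoefficients.

Lemma idset_inj N ids ids' :
  {in ids, forall i, i < N}%N -> {in ids', forall i, i < N}%N ->
  sorted ltn ids -> sorted ltn ids' -> idset N ids = idset N ids' -> ids = ids'.
Proof.
move=> iN iN' s s' /setP E.
apply: (irr_sorted_eq ltn_trans ltnn s s') => i.
have idxE l : {in l, forall i, i < N}%N -> (i < N)%N ->
    (inord i.+1 \in idset N l) = (i \in l).
  move=> lN iiN; rewrite inE; apply/mapP/idP => [[j jl /(congr1 val)]|il].
    by have jN := lN _ jl; rewrite /= !inordK // => -[->].
  by exists i.
case il: (i \in ids); case il': (i \in ids') => //.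
  by have := E (inord i.+1); rewrite !idxE ?il ?il' ?iN.
by have := E (inord i.+1); rewrite !idxE ?il ?il' ?iN'.
Qed.

Lemma content_inj N js js' :
  {in js, forall i, i < N}%N -> {in js', forall i, i < N}%N ->
  sorted leq js -> sorted leq js' ->
  content (map (fun i => inord i.+1 : 'I_N.+1) js) =
  content (map (fun i => inord i.+1 : 'I_N.+1) js') -> js = js'.
Proof.
move=> jN jN' s s' /ffunP E; apply: (sorted_eq leq_trans anti_leq s s').
apply/allP => i; rewrite mem_cat => ij /=.
have iN : (i < N)%N by case/orP: ij => [/jN|/jN'].
have := E (inord i.+1); rewrite !ffunE !count_map.
have cE l : {in l, forall i, i < N}%N ->
    count (preim (fun i => inord i.+1 : 'I_N.+1) (pred1 (inord i.+1))) l = count_mem i l.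
  move=> lN; apply: eq_in_count => j /lN jjN /=.
  by rewrite -(inj_eq val_inj) /= !inordK.
by rewrite !cE // => ->.
Qed.

Lemma F3_intmul_eq0 (u : 'F_3) (m : int) : u != 0 -> (u *~ m == 0) = (3 %| m)%Z.
Proof.
move=> u0; rewrite -mulrzr mulf_eq0 (negPf u0) /=.
by rewrite (dvdz_pcharf (pchar_Fp (isT : prime 3))).
Qed.

Lemma calE_independent (n : nat) (e : 'I_n -> ZX) (c : 'I_n -> int) :
  injective e -> (forall i, in_calE (e i)) ->
  T4 (\sum_(i < n) e i *~ c i) -> forall i, (3 %| c i)%Z.
Proof.
move=> e_inj eE eT4 i1; apply/idPn => c1.
have /choice [js /choice [ids /choice [k d]]] := eE.
(* All variables involved lie below [N], so [inord] is faithful on them. *)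
pose N := (\max_(i < n) \max_(j <- js i ++ ids i) j.+1)%N.
have ltN i j : j \in js i ++ ids i -> (j < N)%N.
  move=> jin; apply: leq_trans (leq_bigmax i).
  exact: (@leq_bigmax_seq _ _ xpredT (fun j => j.+1)).
have jsN i : {in js i, forall j, j < N}%N by move=> j ji; apply: (ltN i); rewrite mem_cat ji.
have idsN i : {in ids i, forall j, j < N}%N.
  by move=> j ji; apply: (ltN i); rewrite mem_cat ji orbT.
have /(@Xform_T4 N) := eT4.
(* Among the coefficients not divisible by 3, one with the fewest thetas is tested at its leading
   term. Another element contributing there has its thetas among these, hence the same ones by
   minimality, then the same prefix. *)
case: (@arg_minnP _ i1 (fun i => ~~ (3 %| c i)%Z) (fun i => size (ids i)) c1).
move=> i0 c0 imin; rewrite raddf_sum /=.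
pose J := content (map (fun i => inord i.+1 : 'I_N.+1) (js i0)).
move/(congr1 (vac_coef (J, ord0 |: idset N (ids i0)))); rewrite raddf_sum raddf0 /=.
have o0 : ord0 \notin idset N (ids i0) by apply: idset0 => ?; apply: idsN.
rewrite (bigD1 i0) //= big1 ?addr0 => [|i ii0]; rewrite !raddfMz /=.
  have [_ sz0 _ s0 ->] := d i0; rewrite Eelt_vac_coef_id //; last exact: idsN.
  move/eqP; rewrite eqxx F3_intmul_eq0 ?(negPf c0) //.
  by rewrite natrX expf_neq0.
have [ci|ci] := boolP (3 %| c i)%Z.
  have [->|v0] := eqVneq (vac_coef (J, ord0 |: idset N (ids i0)) (free_eval (@Xform N) (e i))) 0.
    by rewrite mul0rz.
  by apply/eqP; rewrite F3_intmul_eq0.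
suff -> : vac_coef (J, ord0 |: idset N (ids i0)) (free_eval (@Xform N) (e i)) = 0.
  by rewrite mul0rz.
apply/eqP/negPn/negP => v0; move: v0.
have [_ szi ji si eiE] := d i; have [_ sz0 j0 s0 e0E] := d i0.
rewrite eiE => v0.
have sub : idset N (ids i) \subset idset N (ids i0).
  by apply: Eelt_vac_coef_neq0 v0 => //; exact: idsN.
have idsE : ids i = ids i0.
  apply: (@idset_inj N) => //; apply/eqP; rewrite eqEcard sub !card_idset //; try exact: idsN.
  exact: imin.
have kE : k i = k i0 by move: szi; rewrite idsE sz0; lia.
move: v0; rewrite -idsE Eelt_vac_coef_id //; last exact: idsN.
have [JE _|_] := eqVneq J; last by rewrite mul0rn eqxx.
have jsE : js i = js i0.
  apply: (content_inj (jsN i) (jsN i0) ji j0); rewrite -/J; exact: esym JE.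
have ee : e i = e i0 by rewrite eiE jsE idsE kE -e0E.
by move: ii0; rewrite (e_inj _ _ ee) eqxx.
Qed.

(** * The quotient by T^(4) and the span of E *)

Section Ideals.
Variable S : ZX -> Prop.

Lemma ideal_gen f : S f -> in_ideal S f.
Proof.
move=> Sf; exists 1%N, (fun=> 1), (fun=> 1), (fun=> f); split=> //.
by rewrite big_ord1 mul1r mulr1.
Qed.

Lemma ideal0 : in_ideal S 0.
Proof.
have u : 'I_0 -> ZX by case.
by exists 0%N, u, u, u; split=> [[]//|]; rewrite big_ord0.
Qed.

Lemma idealM u v f : in_ideal S f -> in_ideal S (u * f * v).
Proof.
case=> n [a [b [s [Ss ->]]]]; exists n, (fun i => u * a i), (fun i => b i * v), s.
split=> //; rewrite mulr_sumr mulr_suml; apply: eq_bigr => i _.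
by rewrite !mulrA.
Qed.

Lemma idealD f g : in_ideal S f -> in_ideal S g -> in_ideal S (f + g).
Proof.
case=> n [a [b [s [Ss ->]]]] [m [a' [b' [s' [Ss' ->]]]]].
pose glue (h : 'I_n -> ZX) (h' : 'I_m -> ZX) i :=
  match fintype.split i with inl j => h j | inr j => h' j end.
exists (n + m)%N, (glue a a'), (glue b b'), (glue s s'); split.
  by move=> i; rewrite /glue; case: (fintype.split i).
rewrite big_split_ord /glue; apply: (congr2 +%R); apply: eq_bigr => i _.
  by case: split_ordP => j /eqP; rewrite ?eq_lshift ?eq_lrshift // => /eqP ->.
by case: split_ordP => j /eqP; rewrite ?eq_rshift ?eq_rlshift // => /eqP ->.
Qed.

Lemma idealN f : in_ideal S f -> in_ideal S (- f).
Proof. by move/(idealM (-1) 1); rewrite mulN1r mulr1. Qed.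

Lemma idealB f g : in_ideal S f -> in_ideal S g -> in_ideal S (f - g).
Proof. by move=> Sf /idealN; exact: idealD. Qed.
End Ideals.

(** * The quotient ring by T^(4) *)

Section QuotientT4.
Local Open Scope quotient_scope.

Definition T4pred : {pred ZX} := fun f => `[< T4 f >].

Lemma T4pred_zmod_closed : zmod_closed T4pred.
Proof.
split=> [|f g]; first exact/asboolP/ideal0.
by move=> /asboolP f4 /asboolP g4; apply/asboolP/idealB.
Qed.

HB.instance Definition _ := GRing.isZmodClosed.Build ZX T4pred T4pred_zmod_closed.

Definition ZXT4 : Type := (Quotient.quot T4pred).
HB.instance Definition _ := GRing.Zmodule.on ZXT4.

Definition piT4 (f : ZX) : ZXT4 := \pi_((Quotient.quot T4pred)) f.
Definition reprT4 (a : ZXT4) : ZX := repr (a : (Quotient.quot T4pred)).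

Lemma reprT4K : cancel reprT4 piT4. Proof. exact: reprK. Qed.

Lemma piT4P f g : piT4 f = piT4 g <-> T4 (f - g).
Proof.
rewrite (rwP eqP) /piT4 -[_ == _]/(_ == _ %[mod (Quotient.quot T4pred)]) -Quotient.idealrBE.
by rewrite (rwP (asboolP (T4 (f - g)))).
Qed.

Lemma piT4_eq0 f : piT4 f = 0 <-> T4 f.
Proof. by rewrite -[f in T4 f]subr0 -piT4P /piT4 (raddf0 \pi). Qed.

Lemma piT4_is_zmod_morphism : zmod_morphism piT4.
Proof. exact: (raddfB \pi_((Quotient.quot T4pred))). Qed.

HB.instance Definition _ :=
  GRing.isZmodMorphism.Build ZX ZXT4 piT4 piT4_is_zmod_morphism.

Definition mulT4 (a b : ZXT4) := piT4 (reprT4 a * reprT4 b).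

Lemma piT4M f g : piT4 (f * g) = mulT4 (piT4 f) (piT4 g).
Proof.
have T4r h : T4 (h - reprT4 (piT4 h)) by rewrite -piT4P reprT4K.
apply/piT4P.
have -> : f * g - reprT4 (piT4 f) * reprT4 (piT4 g) =
  1 * (f - reprT4 (piT4 f)) * g + reprT4 (piT4 f) * (g - reprT4 (piT4 g)) * 1 by ncr.
by apply: idealD; apply: idealM; exact: T4r.
Qed.

Lemma mulT4A : associative mulT4.
Proof.
by move=> a b c; rewrite -[a]reprT4K -[b]reprT4K -[c]reprT4K -!piT4M mulrA.
Qed.
Lemma mul1T4 : left_id (piT4 1) mulT4.
Proof. by move=> a; rewrite -[a]reprT4K -!piT4M mul1r. Qed.
Lemma mulT41 : right_id (piT4 1) mulT4.
Proof. by move=> a; rewrite -[a]reprT4K -!piT4M mulr1. Qed.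
Lemma mulT4Dl : left_distributive mulT4 +%R.
Proof.
move=> a b c; rewrite -[a]reprT4K -[b]reprT4K -[c]reprT4K.
by rewrite -raddfD -!piT4M -raddfD mulrDl.
Qed.
Lemma mulT4Dr : right_distributive mulT4 +%R.
Proof.
move=> a b c; rewrite -[a]reprT4K -[b]reprT4K -[c]reprT4K.
by rewrite -raddfD -!piT4M -raddfD mulrDr.
Qed.

HB.instance Definition _ := GRing.Zmodule_isPzRing.Build ZXT4
  mulT4A mul1T4 mulT41 mulT4Dl mulT4Dr.

Lemma piT4_is_monoid_morphism : monoid_morphism piT4.
Proof. by split=> // f g; exact: piT4M. Qed.

HB.instance Definition _ :=
  GRing.isMonoidMorphism.Build ZX ZXT4 piT4 piT4_is_monoid_morphism.

Lemma piT4_comm f g : piT4 (comm f g) = cm (piT4 f) (piT4 g).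
Proof. by rewrite rmorphB !rmorphM. Qed.

Lemma ZXT4_nil (a b c d : ZXT4) : cm (cm3 a b c) d = 0.
Proof.
rewrite -[a]reprT4K -[b]reprT4K -[c]reprT4K -[d]reprT4K /cm3 -!piT4_comm.
by apply/piT4_eq0; apply: ideal_gen; exists (reprT4 a), (reprT4 b), (reprT4 c), (reprT4 d).
Qed.

End QuotientT4.

(** * Rearranging lists by adjacent transpositions *)

Lemma perm_swap_ind (T : eqType) (P : seq T -> Prop) :
  (forall u a b v, P (u ++ a :: b :: v) -> P (u ++ b :: a :: v)) ->
  forall s t, perm_eq s t -> P s -> P t.
Proof.
move=> Psw; suff ind u s t : perm_eq s t -> P (u ++ s) -> P (u ++ t).
  by move=> s t; exact: (ind [::]).
elim: s t u => [|a s IHs] t u st.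
  by case: t st => // b t /perm_size.
have at_ : a \in t by rewrite -(perm_mem st) mem_head.
case/path.splitPr: at_ st => t1 t2 st.
have {}st : perm_eq s (t1 ++ t2).
  by move: st; rewrite perm_sym perm_catC /= perm_cons perm_catC perm_sym.
rewrite -cat_rcons => /(IHs _ _ st); rewrite cat_rcons.
(* The entry [a] now stands before [t1] and moves right across it, one transposition at a time. *)
elim: t1 u {st} => [|b t1 IHt] u //= /Psw; rewrite -cat_rcons => /IHt.
by rewrite cat_rcons.
Qed.

Lemma dup_perm (T : eqType) (s : seq T) :
  ~~ uniq s -> exists a t, perm_eq s [:: a, a & t].
Proof.
elim: s => //= a s IHs; rewrite negb_and negbK => /orP[|/IHs[b [t st]]].
  case/path.splitPr => s1 s2; exists a, (s1 ++ s2).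
  by rewrite perm_cons perm_catC /= perm_cons perm_catC.
exists b, (a :: t); apply: perm_trans (_ : perm_eq (a :: [:: b, b & t]) _).
  by rewrite perm_cons.
by rewrite -[[:: a, b, b & t]]/([:: a] ++ [:: b; b] ++ t) perm_catCA.
Qed.

(** * Straightening products into the integer span of E *)

Section Spanning.
Variable Q : pzRingType.
Hypothesis nilQ : forall a b c d : Q, cm (cm3 a b c) d = 0.

(** Commutators of successive pairs, closed by one triple commutator. Lists of even length or length
    1 give the default 0. *)
Fixpoint comm_prod (l : seq Q) : Q :=
  match l with
  | [:: a; b; c] => cm3 a b c
  | [:: a, b & l'] => cm a b * comm_prod l'
  | _ => 0
  end.

Lemma comm_prodE a b c d l :
  comm_prod [:: a, b, c, d & l] = cm a b * comm_prod [:: c, d & l].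
Proof. by []. Qed.

Lemma comm_prod_cons2 a b l : (1 < size l)%N ->
  comm_prod [:: a, b & l] = cm a b * comm_prod l.
Proof. by case: l => [|? [|? ?]]. Qed.

(** The triple commutator is central, so it passes the pairs and meets the final triple, where
    [cm3_cm3] applies. *)
Lemma cm3_comm_prod a b c l : cm3 a b c * comm_prod l = 0.
Proof.
have [n] := ubnP (size l); elim: n l => // n IHn [|d [|e [|f [|g l]]]];
  try by rewrite /= !mulr0.
  by move=> _; exact: (cm3_cm3 nilQ).
move=> ln; rewrite comm_prodE mulrA (cm3C nilQ) -mulrA IHn ?mulr0 //.
by move: ln => /=; lia.
Qed.

Lemma comm_prod_swap23 p a b c l :
  cm p a * (cm b c * comm_prod l) = - (cm p b * (cm a c * comm_prod l)).
Proof.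
have [n] := ubnP (size l); elim: n l => // n IHn [|d [|e [|f [|g l]]]];
  try by rewrite /= !mulr0 oppr0.
  by move=> _; exact: (cm_cm23_swap nilQ).
move=> ln; rewrite comm_prodE.
have sh u v w t : cm u v * (cm w t * (cm d e * comm_prod [:: f, g & l])) =
    cm d e * (cm u v * (cm w t * comm_prod [:: f, g & l])).
  by rewrite !mulrA -(mulrA (cm u v)) (cmC nilQ w) !mulrA (cmC nilQ u).
by rewrite !sh IHn ?mulrN //; move: ln => /=; lia.
Qed.

(** A transposition inside a pair is antisymmetry, one across two pairs is [comm_prod_swap23], and
    the last five entries form a [cm23]. *)
Lemma comm_prod_swap k u a b v : size (u ++ [:: a, b & v]) = (2 * k + 5)%N ->
  comm_prod (u ++ [:: a, b & v]) = - comm_prod (u ++ [:: b, a & v]).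
Proof.
elim: k u v => [|k IHk] [|p [|q u]] v.
- case: v => [|c [|d [|e [|f v]]]] sz; try by move: sz => /=; lia.
  exact: cm23_swap12.
- case: v => [|c [|d [|e v]]] sz; try by move: sz => /=; lia.
  exact: (cm23_swap23 nilQ).
- case: u v => [|r [|r' u]] [|c [|d v]] sz;
    try by move: sz; rewrite /= ?size_cat /=; lia.
    exact: cm23_swap34.
  exact: (cm23_swap45 nilQ).
- case: v => [|c [|d v]] sz; try by move: sz => /=; lia.
  by rewrite !comm_prodE -mulNr; congr (_ * _); ncr.
- case: v => [|c [|d [|e v]]] sz; try by move: sz => /=; lia.
  exact: (comm_prod_swap23 p a b c [:: d, e & v]).
- move=> sz; have {}sz : size (u ++ [:: a, b & v]) = (2 * k + 5)%N by move: sz => /=; lia.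
  rewrite !cat_cons !comm_prod_cons2 ?IHk ?mulrN //.
    by move: sz; rewrite !size_cat /=; lia.
  by rewrite sz; lia.
Qed.

Variable x : nat -> Q.

Definition mono (js : seq nat) : Q := \prod_(j <- js) x j.

(** The size [2 * k + 5] is [2 * k.+1 + 3], which encodes the condition of at least one pair in
    E. *)
Inductive calE_span : Q -> Prop :=
| CalESpan0 : calE_span 0
| CalESpanB u v : calE_span u -> calE_span v -> calE_span (u - v)
| CalESpanE js ids k : sorted leq js -> sorted ltn ids -> size ids = (2 * k + 5)%N ->
    calE_span (mono js * comm_prod (map x ids)).

Lemma calE_spanN u : calE_span u -> calE_span (- u).
Proof. by rewrite -sub0r; apply: CalESpanB; exact: CalESpan0. Qed.

Lemma calE_spanD u v : calE_span u -> calE_span v -> calE_span (u + v).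
Proof. by move=> su /calE_spanN; rewrite -{2}[v]opprK; exact: CalESpanB. Qed.

Lemma span_sorted js ids k : sorted leq js -> size ids = (2 * k + 5)%N ->
  calE_span (mono js * comm_prod (map x ids)).
Proof.
move=> sjs sz.
pose P (l : seq nat) := size l = (2 * k + 5)%N -> calE_span (mono js * comm_prod (map x l)).
have Psw u a b v : P (u ++ [:: a, b & v]) -> P (u ++ [:: b, a & v]).
  move=> Pu szu; rewrite map_cat /= (@comm_prod_swap k); last first.
    by rewrite -szu !size_cat /= !size_map.
  rewrite mulrN; apply: calE_spanN.
  by have := Pu; rewrite /P map_cat; apply; rewrite -szu !size_cat.
suff [t st Pt] : exists2 t, perm_eq t ids & P t by apply: (perm_swap_ind Psw st Pt).
have [un|/dup_perm[a [t st]]] := boolP (uniq ids).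
  exists (sort leq ids); first by rewrite perm_sort.
  move=> _; apply: (@CalESpanE _ _ k) => //; last by rewrite size_sort.
  by rewrite ltn_sorted_uniq_leq sort_uniq un sort_sorted //; exact: leq_total.
(* A repeated index is brought to the front, where [[x_a,x_a] = 0] annihilates the product. *)
exists [:: a, a & t]; first by rewrite perm_sym.
case: t {st} => [|b [|c t]] szt; try by move: szt => /=; lia.
rewrite /= /cm subrr.
by case: t {szt} => [|d t]; rewrite mul0r mulr0; exact: CalESpan0.
Qed.

(** Induction on the prefix length: exchanging two neighbours costs a term whose prefix is two
    shorter and whose commutator product gains a pair, plus a term killed by [cm3_comm_prod]. *)
Lemma span_comm_prod js ids k : size ids = (2 * k + 5)%N ->
  calE_span (mono js * comm_prod (map x ids)).
Proof.
have [n] := ubnP (size js); elim: n js ids k => // n IHn js ids k jsn sz.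
pose P (l : seq nat) := size l = size js -> calE_span (mono l * comm_prod (map x ids)).
suff: P js by apply.
have Psw u a b v : P (u ++ [:: a, b & v]) -> P (u ++ [:: b, a & v]).
  move=> Pu szu.
  have -> : mono (u ++ [:: b, a & v]) * comm_prod (map x ids) =
      mono (u ++ [:: a, b & v]) * comm_prod (map x ids) -
      (mono (u ++ v) * comm_prod (map x [:: a, b & ids])
       + mono u * (cm3 (x a) (x b) (mono v) * comm_prod (map x ids))).
    have -> : comm_prod (map x [:: a, b & ids]) = cm (x a) (x b) * comm_prod (map x ids).
      by rewrite !map_cons comm_prod_cons2 // size_map sz; lia.
    by rewrite /mono !big_cat /= !big_cons; ncr.
  rewrite cm3_comm_prod mulr0 addr0; apply: CalESpanB.
    by apply: Pu; rewrite -szu !size_cat.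
  apply: (IHn _ _ k.+1); last by rewrite /= sz; lia.
  by move: szu jsn; rewrite !size_cat /=; lia.
apply: (perm_swap_ind Psw (_ : perm_eq (sort leq js) js)); first by rewrite perm_sort.
move=> _; apply: span_sorted sz; apply: sort_sorted; exact: leq_total.
Qed.

Lemma span_mulx i q : calE_span q -> calE_span (x i * q).
Proof.
elim=> [|u v _ su _ sv|js ids k _ _ sz]; first by rewrite mulr0; exact: CalESpan0.
  by rewrite mulrBr; exact: CalESpanB.
rewrite mulrA (_ : x i * mono js = mono (i :: js)); first exact: span_comm_prod sz.
by rewrite /mono big_cons.
Qed.

End Spanning.
Lemma comm_prod_nth (Q : pzRingType) (x : nat -> Q) ids k : size ids = (2 * k + 3)%N ->
  \prod_(t < k) cm (x (nth 0%N ids (2 * t))) (x (nth 0%N ids (2 * t).+1))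
  * cm3 (x (nth 0%N ids (2 * k))) (x (nth 0%N ids (2 * k).+1)) (x (nth 0%N ids (2 * k).+2))
  = comm_prod (map x ids).
Proof.
elim: k ids => [|k IHk] [|a [|b [|c ids]]] sz; try by move: sz => /=; lia.
  by case: ids sz => // _; rewrite big_ord0 mul1r.
have {}sz : size (c :: ids) = (2 * k + 3)%N by move: sz => /=; lia.
rewrite big_ord_recl -mulrA !map_cons comm_prod_cons2; last first.
  by rewrite -map_cons size_map sz; lia.
rewrite -map_cons -(IHk _ sz); congr (_ * (_ * _)).
  by apply: eq_bigr => t _; rewrite lift0 mulnS.
by rewrite mulnS.
Qed.

(** * The image of T^(3,2) in the quotient *)

Section SpanT32.
Local Notation x := (fun i => piT4 (xvar i)).
Local Notation span := (calE_span x).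
Local Notation nilQ := ZXT4_nil.

Lemma word_cons i (w : word) : << (i :: w : word) >> = xvar i * << w >> :> ZX.
Proof. by rewrite malgM_def fgmulUU mulr1. Qed.

Lemma span_mulL f q : span q -> span (piT4 f * q).
Proof.
move=> sq; elim/ZX_ind: f => [|f g sf sg|w].
- by rewrite raddf0 mul0r; exact: CalESpan0.
- by rewrite raddfB mulrBl; exact: CalESpanB.
elim: w => [|i w IHw]; first by rewrite rmorph1 mul1r.
by rewrite word_cons rmorphM -mulrA; apply: (span_mulx ZXT4_nil).
Qed.

(** The product rule reduces words to letters, with left factors absorbed by [span_mulL]; it also
    forces [D 1 = 0]. *)
Lemma span_derivation (D : ZXT4 -> ZXT4) :
  (forall u v, D (u - v) = D u - D v) ->
  (forall u v, D (u * v) = u * D v + v * D u) ->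
  (forall i, span (D (piT4 (xvar i)))) -> forall f, span (D (piT4 f)).
Proof.
move=> DB DM Dx; elim/ZX_ind => [|f g sf sg|w].
- by rewrite raddf0 -(subrr 0) DB subrr; exact: CalESpan0.
- by rewrite raddfB DB; exact: CalESpanB.
elim: w => [|i w IHw].
  have -> : D (piT4 << ([::] : word) >>) = 0; last exact: CalESpan0.
  rewrite rmorph1; apply: (addrI (D 1)); rewrite addr0.
  by rewrite -[in RHS](mulr1 1) DM !mul1r.
rewrite word_cons rmorphM DM; apply: calE_spanD; exact: span_mulL.
Qed.

Lemma span_cm23 f1 f2 f3 f4 f5 :
  span (cm23 (piT4 f1) (piT4 f2) (piT4 f3) (piT4 f4) (piT4 f5)).
Proof.
apply: (span_derivation (D := fun a => cm23 a _ _ _ _)) => [u v|u v|i1];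
  [by ncr|exact: (cm23_M1 nilQ)|].
apply: (span_derivation (D := fun a => cm23 _ a _ _ _)) => [u v|u v|i2];
  [by ncr|exact: (cm23_M2 nilQ)|].
apply: (span_derivation (D := fun a => cm23 _ _ a _ _)) => [u v|u v|i3];
  [by ncr|exact: (cm23_M3 nilQ)|].
apply: (span_derivation (D := fun a => cm23 _ _ _ a _)) => [u v|u v|i4];
  [by ncr|exact: (cm23_M4 nilQ)|].
apply: (span_derivation (D := fun a => cm23 _ _ _ _ a)) => [u v|u v|i5];
  [by ncr|exact: (cm23_M5 nilQ)|].
have := @span_comm_prod _ nilQ x [::] [:: i1; i2; i3; i4; i5] 0 (erefl _).
by rewrite /mono big_nil mul1r.
Qed.

Lemma piT4_gen32 g : gen32 g ->
  piT4 g = 0 \/ exists a b c d e, piT4 g =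
    cm23 (piT4 a) (piT4 b) (piT4 c) (piT4 d) (piT4 e).
Proof.
case=> [g4|[a [b [c [d [e ->]]]]]]; first by left; apply/piT4_eq0/ideal_gen.
by right; exists a, b, c, d, e; rewrite rmorphM /= /comm3 !piT4_comm.
Qed.

Lemma T32_span f : T32 f -> span (piT4 f).
Proof.
case=> n [u [v [s [s32 ->]]]]; rewrite rmorph_sum.
apply: (big_ind (fun q => span q)) => [|p q|i _]; [exact: CalESpan0|exact: calE_spanD|].
rewrite !rmorphM /=; case: (piT4_gen32 (s32 i)) => [->|[a [b [c [d [e ->]]]]]].
  by rewrite mulr0 mul0r; exact: CalESpan0.
(* Centrality moves the right coefficient to the left, so closure under left multiplication is
   enough. *)
rewrite -mulrA (cm23C nilQ); apply: span_mulL; apply: span_mulL; exact: span_cm23.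
Qed.

Lemma T32_mul3 f : T32 f -> T4 (f *+ 3).
Proof.
case=> n [u [v [s [s32 ->]]]]; apply/piT4_eq0; rewrite raddfMn /= raddf_sum -sumrMnl.
apply: big1 => i _; rewrite /= !rmorphM /= -mulrnAl -mulrnAr.
case: (piT4_gen32 (s32 i)) => [->|[a [b [c [d [e ->]]]]]].
  by rewrite mul0rn mulr0 mul0r.
by rewrite (cm23_mul3 nilQ) mulr0 mul0r.
Qed.

Lemma Eelt_comm_prod js ids k : size ids = (2 * k + 3)%N ->
  piT4 (Eelt js ids k) = mono x js * comm_prod (map x ids).
Proof.
move=> sz; rewrite !rmorphM !rmorph_prod /= -mulrA -(comm_prod_nth _ sz).
congr (_ * (_ * _)); last by rewrite /comm3 !piT4_comm.
by apply: eq_bigr => t _; rewrite piT4_comm.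
Qed.

Lemma calE_T32 e : in_calE e -> T32 e.
Proof.
case=> js [ids [[|k] [// _ sz _ _ ->]]].
(* As there is at least one pair, the last pair and the triple form a generator of T^(3,2). *)
rewrite /Eelt big_ord_recr /= mulrA -mulrA -[_ * (_ * _)]mulr1.
apply: idealM; apply: ideal_gen; right.
by do 5 eexists.
Qed.

Lemma calE_span_sum q : span q -> exists s : seq (ZX * int),
  (forall p, p \in s -> in_calE p.1) /\ q = piT4 (\sum_(p <- s) p.1 *~ p.2).
Proof.
elim=> [|u v _ [s [sE ->]] _ [t [tE ->]]|js ids k sjs sids sz].
- by exists [::]; rewrite big_nil raddf0.
- exists (s ++ [seq (p.1, - p.2) | p <- t]); split.
    move=> p; rewrite mem_cat => /orP[/sE//|/mapP[p' /tE ? -> //]].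
  rewrite big_cat big_map /= -raddfB; congr (piT4 (_ + _)).
  by rewrite -sumrN; apply: eq_bigr => p _; rewrite mulrNz.
have {}sz : size ids = (2 * k.+1 + 3)%N by rewrite sz; lia.
exists [:: (Eelt js ids k.+1, 1)]; split.
  by move=> p; rewrite inE => /eqP ->; exists js, ids, k.+1; split.
by rewrite big_seq1 mulr1z Eelt_comm_prod.
Qed.

End SpanT32.

Theorem theorem1p2 :
  (* T^(4) is contained in T^(3,2), so the quotient makes sense *)
  (forall f, T4 f -> T32 f) /\
  (* T^(3,2)/T^(4) is an elementary abelian 3-group *)
  (forall f, T32 f -> T4 (f *+ 3)) /\
  (* the cosets of elements of E lie in T^(3,2)/T^(4) ... *)
  (forall e, in_calE e -> T32 e) /\
  (* ... span it ... *)
  (forall f, T32 f ->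
     exists (n : nat) (e : 'I_n -> ZX) (c : 'I_n -> int),
       (forall i, in_calE (e i)) /\ T4 (f - \sum_(i < n) e i *~ c i)) /\
  (* ... and are linearly independent over F_3 (distinct elements of E). *)
  (forall (n : nat) (e : 'I_n -> ZX) (c : 'I_n -> int),
     injective e -> (forall i, in_calE (e i)) ->
     T4 (\sum_(i < n) e i *~ c i) -> forall i, (3 %| c i)%Z).
Proof.
split; first by move=> f [n [u [v [s [gs ->]]]]]; exists n, u, v, s; split=> // i; left.
split; first exact: T32_mul3.
split; first exact: calE_T32.
split; last exact: calE_independent.
move=> f /T32_span/calE_span_sum[s [sE fE]].
exists (size s), (fun i => (tnth (in_tuple s) i).1), (fun i => (tnth (in_tuple s) i).2).
split; first by move=> i; apply: sE; exact: mem_tnth.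
by apply/piT4P; rewrite fE big_tnth.
Qed.
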